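(* Let $I\subset S$ be a Borel fixed ideal all of whose minimal monomial generators have degree at most $d$, and let $\widetilde I=\operatorname{b-pol}(I)\subset\widetilde S$ be its alternative polarization. Then the complex $\widetilde P_\bullet$ (with the differential $\partial$ described in the context) is a $\mathbb Z^{n\times d}$-graded minimal $\widetilde S$-free resolution of $\widetilde S/\operatorname{b-pol}(I)$.
   Context: Let $\Bbbk$ be a field and $S=\Bbbk[x_1,\dots,x_n]$. For a monomial ideal $J$, $G(J)$ denotes its set of minimal monomial generators. A monomial ideal $I\subset S$ is Borel fixed (strongly stable) if $m\in G(I)$, $x_i\mid m$ and $j<i$ imply $(x_j/x_i)\,m\in I$. Fix such an $I$ and an integer $d$ with $\deg m\le d$ for all $m\in G(I)$. Let $\widetilde S=\Bbbk[x_{i,j}\mid 1\le i\le n,\ 1\le j\le d]$, with the natural $\mathbb Z^{n\times d}$-grading. A monomial $m\in S$ of degree $e\le d$ is written uniquely as $m=\prod_{i=1}^e x_{\alpha_i}$ with $\alpha_1\le\cdots\le\alpha_e$; set $\widetilde m=\operatorname{b-pol}(m):=\prod_{i=1}^e x_{\alpha_i,i}\in\widetilde S$, and $\widetilde I=\operatorname{b-pol}(I):=(\widetilde m\mid m\in G(I))\subset \widetilde S$. For a monomial $m$ let $\mu(m)=\min\{i: x_i\mid m\}$ and $\nu(m)=\max\{i: x_i\mid m\}$ (with $\mu(1)=\infty$). Every monomial $m\in I$ has a unique expression $m=m_1m_2$ with $\nu(m_1)\le\mu(m_2)$ and $m_1\in G(I)$; put $g(m):=m_1$. For a monomial $m=\prod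 x_l^{a_l}$ and $i<\nu(m)$ put $\mathfrak b_i(m):=(x_i/x_k)\,m$ with $k=\min\{j>i: a_j>0\}$. For $m\in G(I)$ put $m_{\langle i\rangle}:=g(\mathfrak b_i(m))$ if $1\le i<\nu(m)$, $m_{\langle i\rangle}:=m$ if $i\ge\nu(m)$, and $\widetilde m_{\langle i\rangle}:=\operatorname{b-pol}(m_{\langle i\rangle})$. For a finite set $\widetilde F=\{(i_1,j_1),\dots,(i_q,j_q)\}\subset\mathbb N\times\mathbb N$ and $m=\prod x_l^{a_l}\in G(I)$, the pair $(\widetilde F,\widetilde m)$ is admissible if (a) $1\le i_1<\cdots<i_q<\nu(m)$ and (b) $j_r=1+\sum_{l=1}^{i_r}a_l$ for all $r$; the pair $(\emptyset,\widetilde m)$ is also admissible. Put $\widetilde F_r:=\widetilde F\setminus\{(i_r,j_r)\}$, and for $(\widetilde F,\widetilde m)$ admissible put $B(\widetilde F,\widetilde m):=\{r\mid 1\le r\le q,\ (\widetilde F_r,\widetilde m_{\langle i_r\rangle})\text{ is admissible}\}$. The complex $\widetilde P_\bullet$: $\widetilde P_0=\widetilde S$, and for $q\ge1$, $\widetilde P_q=\bigoplus \widetilde S\,e(\widetilde F,\widetilde m)$, the sum over admissible pairs with $\#\widetilde F=q-1$, where $e(\widetilde F,\widetilde m)$ is a basis element of degree $\deg\bigl(\widetilde m\prod_{(i,j)\in\widetilde F}x_{i,j}\bigr)\in\mathbb Z^{n\times d}$. The differential $\partial:\widetilde P_{q+1}\to\widetilde P_q$ ($q\ge1$) sends $e(\widetilde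 F,\widetilde m)$ with $\widetilde F=\{(i_1,j_1),\dots,(i_q,j_q)\}$, $i_1<\dots<i_q$, to $$\sum_{1\le r\le q}(-1)^r x_{i_r,j_r}\,e(\widetilde F_r,\widetilde m)-\sum_{r\in B(\widetilde F,\widetilde m)}(-1)^r\frac{x_{i_r,j_r}\,\widetilde m}{\widetilde m_{\langle i_r\rangle}}\,e(\widetilde F_r,\widetilde m_{\langle i_r\rangle}),$$ and $\partial:\widetilde P_1\to\widetilde P_0$ sends $e(\emptyset,\widetilde m)$ to $\widetilde m$. (One has that $\widetilde m_{\langle i_r\rangle}$ divides $x_{i_r,j_r}\widetilde m$.) *)

(* Defs.v *)
From HB Require Import structures.
From mathcomp Require Import all_boot all_order all_algebra.
From mathcomp Require Export mpoly.

Set Implicit Arguments.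
Unset Strict Implicit.
Unset Printing Implicit Defensive.

Import GRing.Theory.
Local Open Scope ring_scope.

Definition ideal_gen (R : comNzRingType) (A : R -> Prop) (f : R) : Prop :=
  exists2 s : seq (R * R),
    (forall x, x \in s -> A x.2) & f = \sum_(x <- s) x.1 * x.2.

(* Monomials and Borel fixed ideals.

   Monomials are identified with their exponents m : 'X_{1..n}, and
   (m1 <= m2)%MM is divisibility. The ordinal i : 'I_n stands for the variable
   x_{i+1}; mu and nu return the usual numbering 1, ..., n. *)

Section Monomials.
Variables (k : fieldType) (n : nat).
Implicit Types (m : 'X_{1..n}) (i j : 'I_n) (I : {pred {mpoly k[n]}}).

Definition monomial_ideal I : Prop :=
  exists A : 'X_{1..n} -> Prop,
    forall f, f \in I <->
      ideal_gen (fun h => exists2 m, A m & h = 'X_[k, m]) f.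

(* m \in G(I). A divisor of m has degree at most mdeg m, so the bounded
   quantifier ranges over all the divisors of m. *)
Definition mingen I m : bool :=
  ('X_[k, m] \in I) &&
  [forall m' : 'X_{1..n < (mdeg m).+1},
     ((m' <= m)%MM && ('X_[k, m'] \in I)) ==> (m' == m :> 'X_{1..n})].

Definition borel_fixed I : Prop :=
  forall m i j, mingen I m -> (0 < m i)%N -> (j < i)%N ->
    'X_[k, (m - U_(i) + U_(j))%MM] \in I.

(* mu 1 = n.+1 plays the role of infinity. *)
Definition mu m : nat := \big[minn/n.+1]_(i < n | (0 < m i)%N) i.+1.

(* nu 1 = 0, so that no index is smaller than nu 1. *)
Definition nu m : nat := \max_(i < n | (0 < m i)%N) i.+1.

(* For m in I, the factor m1 in G(I) of the decomposition m = m1 * m2 with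
   nu m1 <= mu m2; the value outside I is irrelevant. *)
Definition gpart I m : 'X_{1..n} :=
  if [pick m1 : 'X_{1..n < (mdeg m).+1} |
        [&& (m1 <= m)%MM, mingen I m1 & (nu m1 <= mu (m - m1)%MM)%N]]
  is Some m1 then bmnm m1 else m.

(* (x_i / x_k) m, for k the least index > i such that x_k divides m; such a k
   exists as soon as i < nu m. *)
Definition bmove i m : 'X_{1..n} :=
  if [pick k : 'I_n | [&& (i < k)%N, (0 < m k)%N &
        [forall l : 'I_n, (i < l < k)%N ==> (m l == 0%N)]]]
  is Some k then (m - U_(k) + U_(i))%MM else m.

Definition angle I m i : 'X_{1..n} :=
  if (i.+1 < nu m)%N then gpart I (bmove i m) else m.

(* The nondecreasing sequence alpha_1, ..., alpha_e of indices of m. *)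
Definition indices m : seq 'I_n := flatten [seq nseq (m i) i | i <- enum 'I_n].

End Monomials.

(* Alternative polarization.

   The variable x_{i,j} of the polynomial ring in n * d variables is the one of
   index mxvec_index i j; both i and j are numbered from 0. *)

Definition xvar (n d : nat) (p : 'I_n * 'I_d) : 'I_(n * d) :=
  mxvec_index p.1 p.2.

Definition bpol (n d : nat) (m : 'X_{1..n}) : 'X_{1..n * d} :=
  (\sum_(p : 'I_n * 'I_d | onth (indices m) p.2 == Some p.1) U_(xvar p))%MM.

Definition bpol_ideal (k : fieldType) (n d : nat) (I : {pred {mpoly k[n]}}) :
    {mpoly k[n * d]} -> Prop :=
  ideal_gen (fun h => exists2 m, mingen I m & h = 'X_[k, bpol d m]).

Arguments bpol_ideal {k n} d I _ : assert.

(* Z^{n x d}-graded complexes of finite free modules over k[x_{i,j}].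

   The module in homological degree q is free on the finite type cgens q, and
   its elements are the families of coordinates {ffun cgens q -> _}. *)

Definition multideg (n d : nat) (m : 'X_{1..n * d}) : 'M[int]_(n, d) :=
  \matrix_(i, j) (m (mxvec_index i j))%:Z.

Record free_complex (k : fieldType) (n d : nat) := FreeComplex {
  cgens : nat -> finType;
  cdeg : forall q, cgens q -> 'M[int]_(n, d);
  (* images of the basis elements under the differential *)
  cdgen : forall q, cgens q.+1 -> {ffun cgens q -> {mpoly k[n * d]}}
}.

Section Complexes.
Variables (k : fieldType) (n d : nat) (P : free_complex k n d).
Local Notation T := {mpoly k[n * d]}.

Definition cmod q := {ffun cgens P q -> T}.

Definition cdiff q (v : cmod q.+1) : cmod q :=
  [ffun c => \sum_(b : cgens P q.+1) v b * cdgen b c].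

Definition homogeneous q (delta : 'M[int]_(n, d)) (v : cmod q) : Prop :=
  forall b m, m \in msupp (v b) -> multideg m + cdeg b = delta.

Definition graded : Prop :=
  forall q delta (v : cmod q.+1),
    homogeneous delta v -> homogeneous delta (cdiff v).

Definition is_complex : Prop :=
  forall q (v : cmod q.+2), cdiff (cdiff v) = 0.

Definition acyclic : Prop :=
  forall q (v : cmod q.+1), cdiff v = 0 -> exists w : cmod q.+2, cdiff w = v.

(* The differential maps into the product with the ideal of the variables. *)
Definition minimal : Prop :=
  forall q (v : cmod q.+1) c,
    ideal_gen (fun h : T => exists i, h = 'X_i) (cdiff v c).

(* P_0 is the ring itself, with its generator in degree 0, and the image of
   P_1 -> P_0, i.e. the kernel of the augmentation P_0 -> T / J, is J. *)
Definition resolves_quotient (J : T -> Prop) : Prop :=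
  exists2 b0 : cgens P 0,
    (forall b, b = b0) /\ cdeg b0 = 0 &
    [/\ is_complex, acyclic &
        forall f : T, J f <-> exists v : cmod 1, cdiff v b0 = f].

End Complexes.

Section PTilde.
Variables (k : fieldType) (n d : nat) (I : {pred {mpoly k[n]}}).
Implicit Types (F : {set 'I_n * 'I_d}) (m : 'X_{1..n}) (p : 'I_n * 'I_d).

(* The injectivity of fst on F says that i_1 < ... < i_q are distinct. Since
   1 + \sum_(l <= i) a_l <= deg m <= d whenever i < nu m, admissible sets of
   pairs do fit in 'I_n * 'I_d. *)
Definition admissible F m : bool :=
  [&& mingen I m, dinjectiveb fst F &
      [forall p in F, (p.1.+1 < nu m)%N &&
         (p.2.+1 == 1 + \sum_(l < n | (l <= p.1)%N) m l)%N]].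

(* The r such that p = (i_r, j_r). *)
Definition position F p : nat := #|[set p' in F | (p'.1 <= p.1)%N]|.

(* The admissible pairs (F, m) with #F = q; all of G(I) lies in
   'X_{1..n < d.+1} when I is generated in degrees at most d. *)
Definition adm_pair (q : nat) : finType :=
  {x : {set 'I_n * 'I_d} * 'X_{1..n < d.+1} |
     admissible x.1 x.2 && (#|x.1| == q)}.

Definition apF q (b : adm_pair q) : {set 'I_n * 'I_d} := (sval b).1.
Definition apm q (b : adm_pair q) : 'X_{1..n} := (sval b).2.

Definition Pgens (q : nat) : finType :=
  if q is q'.+1 then adm_pair q' else unit.

Definition Pdeg (q : nat) : Pgens q -> 'M[int]_(n, d) :=
  match q return Pgens q -> _ with
  | 0 => fun=> 0
  | q'.+1 => fun b =>
      multideg (bpol d (apm b) + \sum_(p in apF b) U_(xvar p))%MM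
  end.

(* The basis element e(F, m) of P_(q+1), for (F, m) admissible with #F = q. *)
Definition Pelt (q : nat) F m : {ffun adm_pair q -> {mpoly k[n * d]}} :=
  [ffun c => ((apF c == F) && (apm c == m))%:R].

(* The difference of exponents below is the quotient
   x_{i_r,j_r} bpol(m) / bpol(m_<i_r>). *)
Definition Pdgen (q : nat) :
    Pgens q.+1 -> {ffun Pgens q -> {mpoly k[n * d]}} :=
  match q return Pgens q.+1 -> {ffun Pgens q -> _} with
  | 0 => fun b => [ffun=> 'X_[k, bpol d (apm b)]]
  | q'.+1 => fun b => let F := apF b in let m := apm b in
      [ffun c =>
        \sum_(p in F)
          (-1) ^+ position F p * 'X_(xvar p) * Pelt q' (F :\ p) m c
        - \sum_(p in F | admissible (F :\ p) (angle I m p.1))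
          (-1) ^+ position F p
          * 'X_[k, (U_(xvar p) + bpol d m - bpol d (angle I m p.1))%MM]
          * Pelt q' (F :\ p) (angle I m p.1) c]
  end.

Definition Ptilde : free_complex k n d := FreeComplex Pdeg Pdgen.

End PTilde.

(* Main.v *)
(* The quotient of two consecutive steps of the filtration of the complex by the
   generators of I, in decreasing lexicographic order, is the Koszul complex on
   the variables x_{i,j} with i < nu m and j = 1 + a_1 + ... + a_i, as m_<i> is
   lexicographically larger than m. The colon ideal of the polarizations of the
   larger generators by that of m lies in the ideal of these variables. So the
   part of a cycle at the last generator in its support is a Koszul boundary, and
   subtracting its image shortens the support.

   Write s_m(t) for the sum of the exponents a_l of m with l < t. Multiplication
   by x_i / x_k, truncation to a prefix, polarization and admissibility have
   piecewise linear descriptions in s_m; this reduces the identities behind the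
   vanishing of the square of the differential to linear arithmetic. *)
Require Import Defs.
From mathcomp Require Import all_boot all_order all_algebra.
From mathcomp Require Import zify ring.

Set Implicit Arguments.
Unset Strict Implicit.
Unset Printing Implicit Defensive.

Import GRing.Theory.
Local Open Scope ring_scope.

(** The length at which [gpart] cuts is known only through bounds, so linear arithmetic alone cannot
    compare iterated moves. Both sides are instead exhibited as truncations of one common sequence,
    and minimality of generators forces two such truncations to agree.

    The terms of the square do not cancel uniformly, because the differential drops nonadmissible
    targets. For [p.1 < q.1] everything depends on whether [q] stays active after the move at [p].
    If it does, the two moves commute; if not, the move at [p] absorbs the one at [q], and the
    dropped terms are matched by a cancellation in the other order.

    Cycles are arbitrary, not homogeneous, in the acyclicity argument. Division by one active
    variable at a time gives an explicit Koszul homotopy. What survives at the last generator sits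
    on the empty set and has no monomial divisible by an active variable. Above homological degree
    one nothing of this kind exists, so the colon ideal intervenes only in degree one. *)

(** * Partial sums of exponents, prefixes and truncations *)

Section PartialSums.
Variable n : nat.
Implicit Types (m : 'X_{1..n}) (i j : 'I_n) (t e : nat).

Definition psum m t : nat := (\sum_(l < n | (l < t)%N) m l)%N.

Lemma psum0 m : psum m 0 = 0%N.
Proof. by rewrite /psum big_pred0. Qed.

Lemma psumS m i : psum m i.+1 = (psum m i + m i)%N.
Proof.
rewrite /psum (bigD1 i) //= addnC; congr (_ + _)%N.
by apply: eq_bigl => l; rewrite ltnS -val_eqE /=; lia.
Qed.

Lemma psum_mdeg m t : (n <= t)%N -> psum m t = mdeg m.
Proof.
move=> nt; rewrite mdegE; apply: eq_bigl => l.
by rewrite (leq_trans (ltn_ord l) nt).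
Qed.

Lemma psum_le m s t : (s <= t)%N -> (psum m s <= psum m t)%N.
Proof.
move=> st; rewrite /psum [leqRHS](bigID (fun l : 'I_n => (l < s)%N)) /=.
rewrite (eq_bigl (fun l : 'I_n => (l < t)%N && (l < s)%N)) ?leq_addr //.
by move=> l; lia.
Qed.

Lemma psum_le_mdeg m t : (psum m t <= mdeg m)%N.
Proof.
by rewrite -(psum_mdeg m (leq_addr t n)); apply/psum_le/leq_addl.
Qed.

Lemma psum_const m s t :
  (forall l : 'I_n, (s <= l < t)%N -> m l = 0%N) -> (s <= t)%N ->
  psum m t = psum m s.
Proof.
move=> m0 st; rewrite /psum (bigID (fun l : 'I_n => (l < s)%N)) /=.
rewrite [X in (_ + X)%N]big1 ?addn0.
  by apply: eq_bigl => l; lia.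
by move=> l lt; apply: m0; lia.
Qed.

Lemma psumD m1 m2 t : psum (m1 + m2)%MM t = (psum m1 t + psum m2 t)%N.
Proof. by rewrite /psum -big_split; apply: eq_bigr => l _; rewrite mnmDE. Qed.

Lemma psumU i t : psum U_(i)%MM t = (i < t)%N.
Proof.
rewrite /psum; case: ltnP => it.
  rewrite (bigD1 i) //= mnm1E eqxx big1 // => l /andP[_ /negPf li].
  by rewrite mnm1E eq_sym li.
by rewrite big1 // => l lt; rewrite mnm1E -val_eqE /=; lia.
Qed.

Lemma psumB m1 m2 t : (m1 <= m2)%MM ->
  (psum m1 t + psum (m2 - m1)%MM t)%N = psum m2 t.
Proof. by move=> le12; rewrite -psumD addmC submK. Qed.

Lemma psum_inj m1 m2 : (forall t, psum m1 t = psum m2 t) -> m1 = m2.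
Proof.
move=> eq12; apply/mnmP => i.
by have := eq12 i.+1; rewrite !psumS eq12 => /addnI.
Qed.

Lemma mnmle_ltn m1 m2 : (m1 <= m2)%MM -> m1 != m2 ->
  exists l, (m1 l < m2 l)%N.
Proof.
move=> /mnm_lepP le12 ne12; apply/existsP; apply: contraNT ne12.
rewrite negb_exists => /forallP h; apply/eqP/mnmP => l.
by have := h l; have := le12 l; lia.
Qed.

Lemma mnmle_mdeg m1 m2 : (m1 <= m2)%MM -> (mdeg m1 <= mdeg m2)%N.
Proof. by move=> /submK <-; rewrite mdegD leq_addl. Qed.

Lemma mnmlt_mdeg m1 m2 : (m1 <= m2)%MM -> m1 != m2 -> (mdeg m1 < mdeg m2)%N.
Proof.
move=> le12 /(mnmle_ltn le12)[l lt_l].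
rewrite -(submK le12) mdegD -[ltnLHS]add0n ltn_add2r lt0n mdeg_eq0.
by apply/eqP => /mnmP/(_ l); rewrite mnmBE mnm0E; lia.
Qed.

(** As [nu] counts from 1 and [t] from 0, both sides say that some variable of index at least [t]
    divides [m]. *)
Lemma ltn_nu m t : (t < nu m)%N = (psum m t < mdeg m)%N.
Proof.
rewrite !ltnNge; congr negb; apply/bigmax_leqP/idP => [h|h i mi].
  case: (leqP n t) => nt; first by rewrite psum_mdeg.
  rewrite -(psum_mdeg m (leqnn n)) (@psum_const m t n) // ?(ltnW nt) //.
  move=> l /andP[tl _]; apply/eqP; rewrite -leqn0 leqNgt.
  by apply/negP => /h; lia.
rewrite ltnNge; apply/negP => ti.
have := psum_le m ti; have := psumS m i; have := psum_le_mdeg m i.+1; lia.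
Qed.

Lemma leq_nu_mu m1 m2 :
  (nu m1 <= mu m2)%N <->
  (forall i j, (0 < m1 i)%N -> (0 < m2 j)%N -> (i <= j)%N).
Proof.
have muP x : (x <= n.+1)%N ->
    (x <= mu m2)%N <-> (forall j, (0 < m2 j)%N -> (x <= j.+1)%N).
  move=> xn.
  rewrite /mu; split=> [h j mj|h].
    apply: leq_trans h _; have := mem_index_enum j.
    elim: (index_enum _) => //= a s IH; rewrite big_cons inE.
    case/predU1P=> [<-|/IH]; first by rewrite mj geq_minl.
    by case: ifP => // _; apply: leq_trans; rewrite geq_minr.
  by elim/big_ind: _ => // a b xa xb; rewrite leq_min xa.
have nun : (nu m1 <= n.+1)%N by apply/bigmax_leqP => i _; have := ltn_ord i; lia.
rewrite muP //; split=> [h i j mi /h|h j mj].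
  by move/bigmax_leqP/(_ i mi); rewrite ltnS.
by apply/bigmax_leqP => i mi; rewrite ltnS h.
Qed.

(** The nondecreasing index sequence of [m1] is an initial segment of that of [m]: counting the
    entries below [t] stops at the length [mdeg m1]. *)
Definition prefix m1 m := forall t, psum m1 t = minn (psum m t) (mdeg m1).

(** A factor of [m - m1] below [t] forces all of [m1] below [t], and the minimum is then [mdeg m1];
    without such a factor it is [psum m t]. *)
Lemma prefixP m1 m :
  (m1 <= m)%MM && (nu m1 <= mu (m - m1)%MM)%N <-> prefix m1 m.
Proof.
split=> [/andP[le1 /leq_nu_mu nm] t|pre].
  rewrite -(psumB t le1); have := psum_le_mdeg m1 t.
  case: (posnP (psum (m - m1)%MM t)) => [->|mpos]; first by lia.
  move=> le_t; suff -> : mdeg m1 = psum m1 t by lia.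
  have [j jt mj] : exists2 j : 'I_n, (j < t)%N & (0 < (m - m1)%MM j)%N.
    apply/exists_inP; move: mpos; apply: contraLR; rewrite negb_exists_in.
    move=> /forall_inP h; rewrite -leqNgt leqn0 /psum.
    by apply/eqP/big1 => j /h; lia.
  rewrite -(psum_mdeg m1 (leq_addr t n)).
  apply: psum_const; last exact: leq_addl.
  move=> l /andP[tl _]; apply/eqP; rewrite -leqn0 leqNgt.
  by apply/negP => /nm /(_ mj); lia.
have le1 : (m1 <= m)%MM.
  apply/mnm_lepP => i; have := pre i; have := pre i.+1; rewrite !psumS; lia.
rewrite le1; apply/leq_nu_mu => i j mi mj.
rewrite leqNgt; apply/negP => ji.
have := psumB j.+1 le1; have := psumB j le1; have := psumS (m - m1)%MM j.
have := psum_le m1 ji; have := psumS m1 i; have := psum_le_mdeg m1 i.+1.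
have := pre j.+1; have := pre j; lia.
Qed.

Lemma prefix_le m1 m : prefix m1 m -> (m1 <= m)%MM.
Proof. by move=> /prefixP /andP[]. Qed.

Definition trunc e m : 'X_{1..n} :=
  [multinom minn (psum m i.+1) e - minn (psum m i) e | i < n]%N.

Lemma psum_trunc e m t : psum (trunc e m) t = minn (psum m t) e.
Proof.
elim: t => [|t IH]; first by rewrite !psum0 min0n.
case: (ltnP t n) => [tn|nt]; last by
  have := IH; rewrite !psum_mdeg //; apply: leqW.
have := psumS (trunc e m) (Ordinal tn); rewrite mnmE /= IH => ->.
by have := psum_le m (leqnSn t); lia.
Qed.

Lemma mdeg_trunc e m : mdeg (trunc e m) = minn (mdeg m) e.
Proof. by rewrite -(psum_mdeg _ (leqnn n)) psum_trunc psum_mdeg. Qed.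

Lemma prefix_trunc e m : prefix (trunc e m) m.
Proof.
by move=> t; rewrite psum_trunc mdeg_trunc; have := psum_le_mdeg m t; lia.
Qed.

(** Replacing the next factor [x_k] by [x_i] adds 1 exactly for [i < t <= k], where the partial sums
    of [m] are constant; past [k] they already exceed that constant. Hence the maximum. The
    hypothesis provides [k]. *)
Lemma psum_bmove m i t : (psum m i.+1 < mdeg m)%N ->
  psum (bmove i m) t =
    if (t <= i)%N then psum m t else maxn (psum m t) (psum m i.+1).+1.
Proof.
move=> lt_m; have kP : exists k : nat,
    [exists l : 'I_n, [&& (l : nat) == k, (i < l)%N & (0 < m l)%N]].
  have : [exists l : 'I_n, (i < l)%N && (0 < m l)%N].
    move: lt_m; apply: contraLR; rewrite negb_exists -leqNgt => /forallP h.
    rewrite -(psum_mdeg m (leqnn n)) (@psum_const m i.+1 n) //.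
    by move=> l /andP[il _]; have := h l; rewrite il /=; lia.
  by case/existsP => l ilm; exists l; apply/existsP; exists l; rewrite eqxx.
have [/= k0 /existsP[k /and3P[/eqP kk0 ik mk]] kmin] := ex_minnP kP.
rewrite /bmove; case: pickP => [/= l|/(_ k)]; last first.
  rewrite ik mk /= => /negbT /negP[]; apply/forallP => l; apply/implyP => lk.
  rewrite -leqn0 leqNgt; apply/negP => ml; suff : (k0 <= l)%N by lia.
  by apply: kmin; apply/existsP; exists l; rewrite eqxx ml; lia.
move=> {k0 k kk0 ik mk kmin kP} /and3P[il ml /forallP lmin].
have Ule : (U_(l) <= m)%MM.
  by apply/mnm_lepP => j; rewrite mnm1E; case: eqP => // <-.
rewrite psumD psumU; have := psumB t Ule; rewrite psumU.
have psum_l : psum m l = psum m i.+1.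
  apply: psum_const => // j jl; apply/eqP.
  by have /implyP := lmin j; apply; lia.
case: (leqP t i) => [ti|it]; first by lia.
case: (leqP t l) => [tl|lt].
  by have := psum_le m tl; have := psum_le m it; lia.
by have := psum_le m lt; have := psumS m l; lia.
Qed.

End PartialSums.

(** * Generators and the operations on them *)

Section IdealGen.
Variables (R : comNzRingType) (A : R -> Prop).

Lemma ideal_gen0 : ideal_gen A 0.
Proof. by exists [::]; rewrite ?big_nil. Qed.

Lemma ideal_genD f g : ideal_gen A f -> ideal_gen A g -> ideal_gen A (f + g).
Proof.
move=> [s sA ->] [t tA ->]; exists (s ++ t); last by rewrite big_cat.
by move=> x; rewrite mem_cat => /orP[/sA|/tA].
Qed.

Lemma ideal_genM f g : ideal_gen A g -> ideal_gen A (f * g).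
Proof.
move=> [s sA ->]; exists [seq (f * x.1, x.2) | x <- s].
  by move=> _ /mapP[x /sA Ax ->].
by rewrite big_map mulr_sumr; apply: eq_bigr => x _; rewrite mulrA.
Qed.

Lemma ideal_gen_sub f : A f -> ideal_gen A f.
Proof.
move=> Af; exists [:: (1, f)]; last by rewrite big_seq1 mul1r.
by move=> x; rewrite inE => /eqP ->.
Qed.

Lemma ideal_gen_sum (J : finType) (F : J -> R) :
  (forall j, ideal_gen A (F j)) -> ideal_gen A (\sum_j F j).
Proof.
by move=> h; elim/big_ind: _ => //; [apply: ideal_gen0 | apply: ideal_genD].
Qed.

End IdealGen.

Section Borel.
Variables (k : fieldType) (n : nat) (I : {pred {mpoly k[n]}}).
Hypotheses (I_monomial : monomial_ideal I) (I_borel : borel_fixed I).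
Implicit Types (m a b : 'X_{1..n}) (i j : 'I_n) (t e : nat).
Local Notation "m \inI" := ('X_[k, m] \in I) (at level 10).

Lemma inI_le m1 m2 : (m1 <= m2)%MM -> m1 \inI -> m2 \inI.
Proof.
case: I_monomial => A AP le12 /AP h; apply/AP.
by rewrite -(submK le12) mpolyXD; apply: ideal_genM.
Qed.

Lemma mingenP m : reflect
  (m \inI /\ forall m', (m' <= m)%MM -> m' \inI -> m' = m) (mingen I m).
Proof.
apply: (iffP andP) => -[mI h]; split=> //.
  move=> m' le mI'; have lt : (mdeg m' < (mdeg m).+1)%N by rewrite ltnS mnmle_mdeg.
  by have /forallP/(_ (BMultinom lt))/implyP := h; rewrite /= le => /(_ mI')/eqP.
by apply/forallP => m'; apply/implyP => /andP[le mI']; rewrite (h m').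
Qed.

(** Induction on the degree: a proper divisor of [m] in [I] either misses [x_i], and then still
    divides the exchanged monomial, or its own exchange does. *)
Lemma inI_borel m i j : m \inI -> (0 < m i)%N -> (j < i)%N ->
  (m - U_(i) + U_(j))%MM \inI.
Proof.
move=> + + ji; have [e] := ubnP (mdeg m); elim: e m => // e IH m lt_e mI mi.
have [gen_m|] := boolP (mingen I m); first exact: I_borel.
rewrite /mingen mI negb_forall => /existsP[b].
rewrite negb_imply; move: (bmnm b) => m' /andP[/andP[le mI'] ne].
have lt_deg := mnmlt_mdeg le ne.
have [mi'0|mi'] := posnP (m' i).
  apply: inI_le mI'; apply/mnm_lepP => x; rewrite mnmDE mnmBE !mnm1E.
  have /mnm_lepP/(_ x) := le; case: (i =P x) => [<-|_]; case: (j == _); lia.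
apply: inI_le (IH m' _ mI' mi'); last by lia.
apply/mnm_lepP => x; rewrite !mnmDE !mnmBE !mnm1E.
by have /mnm_lepP/(_ x) := le; case: (i == x); case: (j == x); lia.
Qed.

(** Of two truncations of the same sequence one divides the other. The function [f] need not come
    from a monomial in [I], and the lengths [e1] and [e2] may stay unknown. *)
Lemma prefix_uniq (f : nat -> nat) e1 e2 a b : mingen I a -> mingen I b ->
  (forall t, psum a t = minn (f t) e1) -> (forall t, psum b t = minn (f t) e2) ->
  a = b.
Proof.
wlog le12 : a b e1 e2 / (e1 <= e2)%N => [wlg ga gb fa fb|].
  case: (leqP e1 e2) => le; first exact: wlg le _ _ _ _.
  by apply/esym; apply: wlg (ltnW le) _ _ _ _.
move=> /mingenP[aI _] /mingenP[_ minb] fa fb; apply: minb => //.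
have deg_a : mdeg a = minn (f n) e1 by rewrite -(psum_mdeg a (leqnn n)).
by apply/prefix_le => t; have := psum_le_mdeg a t; rewrite deg_a fa fb; lia.
Qed.

(** The shortest truncation lying in [I] is a generator. Otherwise it stays in [I] after division by
    some [x_l]; exchanging its last factor [x_i] for [x_l] shows that division by [x_i] also stays
    in [I], which gives a shorter truncation. *)
Lemma gpart_exists m : m \inI -> exists2 m1, mingen I m1 & prefix m1 m.
Proof.
move=> mI; have [|e eI emin] := @ex_minnP (fun e => trunc e m \inI).
  exists (mdeg m); suff -> : trunc (mdeg m) m = m by [].
  by apply: psum_inj => t; rewrite psum_trunc; have := psum_le_mdeg m t; lia.
exists (trunc e m); last exact: prefix_trunc.
apply/mingenP; split=> // m' le mI'; apply/eqP/negPn/negP => ne.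
have [l lt_l] := mnmle_ltn le ne.
have e_m : (e <= mdeg m)%N.
  apply: emin; suff -> : trunc (mdeg m) m = m by [].
  by apply: psum_inj => t; rewrite psum_trunc; have := psum_le_mdeg m t; lia.
have e0 : (0 < e)%N by move: lt_l; rewrite mnmE; lia.
(* The last factor of the truncation has index one less than this [t]. *)
have [t te tmin] := @ex_minnP (fun t => e <= psum m t)%N
   (ex_intro _ n (eq_ind _ (leq e) e_m _ (esym (psum_mdeg m (leqnn n))))).
case: t te tmin => [|t] te tmin; first by rewrite psum0 in te; lia.
have tn : (t < n)%N by apply: tmin; rewrite psum_mdeg.
pose i := Ordinal tn.
have ti : (psum m t < e)%N by rewrite ltnNge; apply/negP => /tmin; lia.
have li : (l <= i)%N.
  rewrite leqNgt; apply/negP => il; move: lt_l; rewrite mnmE.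
  by have := psum_le m il; have := psum_le m (leqnSn l); rewrite /=; lia.
have m1i : (0 < trunc e m i)%N by rewrite mnmE /=; lia.
have m1lI : (trunc e m - U_(l))%MM \inI.
  apply: inI_le mI'; apply/mnm_lepP => x; rewrite mnmBE mnm1E.
  have /mnm_lepP/(_ x) := le; case: eqP => [<-|]; lia.
suff /emin : trunc e.-1 m \inI by lia.
have: (trunc e m - U_(i))%MM \inI.
  have [<-//|ne_li] := eqVneq l i.
  have lt_li : (l < i)%N.
    by rewrite ltn_neqAle li andbT.
  have := inI_borel m1lI (i := i) (j := l); rewrite mnmBE mnm1E.
  rewrite (negPf ne_li) subn0 => /(_ m1i lt_li); apply: inI_le.
  apply/mnm_lepP => x; rewrite mnmDE !mnmBE !mnm1E.
  case: (l =P x) => [<-|_]; last by case: (i == x); lia.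
  by rewrite eq_sym (negPf (ne_li : l != i)); lia.
apply: inI_le; apply/mnm_lepP => x; rewrite mnmBE mnm1E.
rewrite !mnmE; case: (i =P x) => [<- /=|ne_ix]; first by lia.
case: (ltnP x i) => xi.
  by have := psum_le m xi; have := psum_le m (leqnSn x); rewrite /=; lia.
have ix : (i < x)%N by rewrite ltn_neqAle xi andbT; apply/eqP => /val_inj.
by have := psum_le m ix; have := psum_le m (leqnSn x); rewrite /=; lia.
Qed.

Lemma gpartP m : m \inI -> mingen I (gpart I m) /\ prefix (gpart I m) m.
Proof.
move=> /gpart_exists[m1 gen1 pre1]; rewrite /gpart; case: pickP => /=.
  by move=> m2 /and3P[le2 gen2 nu2]; split=> //; apply/prefixP; rewrite le2.
have lt : (mdeg m1 < (mdeg m).+1)%N by rewrite ltnS mnmle_mdeg ?prefix_le.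
by move=> /(_ (BMultinom lt)) /=; rewrite gen1 /= => /negP[]; apply/prefixP.
Qed.

Lemma bmove_inI m i : mingen I m -> (bmove i m) \inI.
Proof.
move=> gen_m; rewrite /bmove; case: pickP => [l /and3P[il ml _]|_].
  exact: I_borel.
by case/mingenP: gen_m.
Qed.

(** The cut made by [gpart] keeps the moved factor: a shorter prefix of the moved monomial would
    already be a prefix of [m], hence equal to [m] by minimality, and too long. *)
Lemma angleP m i : mingen I m -> (psum m i.+1 < mdeg m)%N ->
  [/\ mingen I (angle I m i), (psum m i.+1 < mdeg (angle I m i))%N,
      (mdeg (angle I m i) <= mdeg m)%N &
      forall t, psum (angle I m i) t =
        minn (if (t <= i)%N then psum m t
              else maxn (psum m t) (psum m i.+1).+1) (mdeg (angle I m i))].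
Proof.
move=> gen_m lt_m; rewrite /angle ltn_nu lt_m.
have [] := gpartP (bmove_inI i gen_m).
set a := gpart I _ => gen_a pre_a.
have psum_a t := pre_a t.
have le_am : (mdeg a <= mdeg m)%N.
  rewrite (leq_trans (mnmle_mdeg (prefix_le pre_a))) //.
  rewrite -(psum_mdeg _ (leqnn n)) psum_bmove // psum_mdeg //.
  by rewrite (leqNgt n i) ltn_ord /= geq_max leqnn.
split=> // [|t]; last by rewrite psum_a psum_bmove.
rewrite ltnNge; apply/negP => le_a; case/mingenP: gen_m => _ min_m.
suff am : a = m by move: le_a; rewrite am; lia.
case/mingenP: gen_a => aI _; apply: min_m => //.
apply/prefix_le => t; rewrite psum_a psum_bmove //.
by case: leqP => // /(psum_le m); lia.
Qed.

End Borel.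

(** * Polarization in terms of partial sums *)

Lemma big_take_enum n (m : 'X_{1..n}) t : (t <= n)%N ->
  (\sum_(x <- take t (enum 'I_n)) m x)%N = psum m t.
Proof.
elim: t => [|t IH] tn; first by rewrite take0 big_nil psum0.
rewrite (take_nth (Ordinal tn)) ?size_enum_ord // -cats1 big_cat big_seq1 /=.
rewrite IH; last exact: ltnW.
rewrite (nth_ord_enum (Ordinal tn) (Ordinal tn)).
by rewrite (psumS m (Ordinal tn)).
Qed.

Lemma onth_flatten_nseq (T : eqType) (f : T -> nat) (s : seq T) (i : T) (j : nat) :
  uniq s -> i \in s ->
  (onth (flatten [seq nseq (f x) x | x <- s]) j == Some i) =
  (\sum_(x <- take (index i s) s) f x <= j <
   \sum_(x <- take (index i s) s) f x + f i)%N.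
Proof.
elim: s j => //= x s IH j /andP[xs us]; rewrite inE onth_cat size_nseq onth_nseq.
case: (eqVneq i x) => [-> _|ne /= i_s].
  rewrite big_nil /= add0n; case: ltnP => // le; first by rewrite eqxx.
  apply/negbTE; move: (j - f x)%N; apply/onthPn; apply: contra xs.
  by case/flatten_mapP => y ys; rewrite mem_nseq => /andP[_ /eqP ->].
rewrite big_cons; case: ltnP => lt; last by rewrite IH //; lia.
rewrite (inj_eq Some_inj) eq_sym (negPf ne).
by apply/esym/negbTE; lia.
Qed.

Section Polarization.
Variables n d : nat.
Implicit Types (m : 'X_{1..n}) (p q : 'I_n * 'I_d).

Lemma onth_indices m (i : 'I_n) j :
  (onth (indices m) j == Some i) = (psum m i <= j < psum m i.+1)%N.
Proof.
rewrite onth_flatten_nseq ?enum_uniq ?mem_enum // index_enum_ord psumS.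
by rewrite big_take_enum ?(ltnW (ltn_ord i)).
Qed.

Lemma xvar_inj : injective (@xvar n d).
Proof.
case: (curry_mxvec_bij n d) => g gK _ [i1 j1] [i2 j2] /(congr1 g).
by rewrite [g _](gK (i1, j1)) // [g _](gK (i2, j2)).
Qed.

Lemma bpolE m p :
  bpol d m (xvar p) = (psum m p.1 <= p.2 < psum m p.1.+1)%N.
Proof.
rewrite mnm_sumE -onth_indices.
under eq_bigr do rewrite mnm1E (inj_eq xvar_inj).
case: (boolP (onth _ _ == _)) => h; last rewrite big1 // => q hq.
  rewrite (bigD1 p) //= eqxx big1 // => q /andP[_ /negPf ->] //.
by case: (eqVneq q p) => // qp; move: hq; rewrite qp (negPf h).
Qed.

Lemma mnm_xvarP (a b : 'X_{1..n * d}) :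
  (forall p, a (xvar p) <= b (xvar p))%N -> (a <= b)%MM.
Proof.
by move=> h; apply/mnm_lepP => x; case/mxvec_indexP: x => i j; apply: (h (i, j)).
Qed.

Lemma psum_find m j : (j < mdeg m)%N ->
  exists i : 'I_n, (psum m i <= j < psum m i.+1)%N.
Proof.
move=> lt_j; have [[|t] lt_t tmin] := @ex_minnP (fun t => j < psum m t)%N
  (ex_intro _ n (eq_ind _ (leq j.+1) lt_j _ (esym (psum_mdeg m (leqnn n))))).
  by rewrite psum0 in lt_t.
have tn : (t < n)%N by apply: tmin; rewrite psum_mdeg.
exists (Ordinal tn); rewrite lt_t andbT leqNgt.
by apply/negP => /tmin; rewrite ltnn.
Qed.

End Polarization.

(** * The square of the differential *)

Lemma position_rem (n d : nat) (F : {set 'I_n * 'I_d}) p q :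
  p \in F -> position F q = ((p.1 <= q.1) + position (F :\ p) q)%N.
Proof.
move=> pF; rewrite /position (cardsD1 p) inE pF /=; congr (_ + _)%N.
by apply: eq_card => x; rewrite !inE; case: (x == p).
Qed.

(** Only the removal of the element with the smaller first index shifts the position of the other,
    so exactly one sign changes. *)
Lemma sign_position (R : pzRingType) (n d : nat) (F : {set 'I_n * 'I_d}) p q :
  p \in F -> q \in F -> p.1 != q.1 ->
  (-1) ^+ position F p * (-1) ^+ position (F :\ p) q =
  - ((-1) ^+ position F q * (-1) ^+ position (F :\ q) p) :> R.
Proof.
move=> pF qF; rewrite -(inj_eq val_inj) /= => pq.
rewrite (position_rem p qF) (position_rem q pF) !exprD.
case: (ltngtP p.1 q.1) pq => //= _ _; rewrite !expr1 !expr0 !mul1r.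
  by rewrite mulN1r mulNr opprK -!exprD addnC.
by rewrite mulN1r mulNr -!exprD addnC.
Qed.

Lemma sum_antisym (T : finType) (R : zmodType) (F : {set T}) (f : T -> nat)
    (t : T -> T -> R) : {in F &, injective f} ->
  (forall p q, p \in F -> q \in F -> (f p < f q)%N -> t p q + t q p = 0) ->
  \sum_(p in F) \sum_(q in F :\ p) t p q = 0.
Proof.
move=> f_inj t_anti.
pose lt p q := (f p < f q)%N.
have split_lt p : p \in F -> \sum_(q in F :\ p) t p q =
    \sum_(q in F | lt p q) t p q + \sum_(q in F | lt q p) t p q.
  move=> pF; rewrite (bigID (lt p)) /=; congr (_ + _); apply: eq_bigl => q.
    rewrite !inE; case: (eqVneq q p) => [->|] //=.
    by rewrite /lt ltnn andbF.
  rewrite !inE /lt; case: (eqVneq q p) => [->|qp] /=.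
    by rewrite ltnn andbF.
  case qF: (q \in F) => //=; rewrite -leqNgt leq_eqVlt; case: eqP => // fqp.
  by rewrite (f_inj _ _ qF pF fqp) eqxx in qp.
have swap : \sum_(p in F) \sum_(q in F | lt q p) t p q =
    \sum_(p in F) \sum_(q in F | lt p q) t q p.
  rewrite (exchange_big_dep (mem F)) /=; last by move=> p q _ /andP[].
  by apply: eq_bigr => p pF; apply: eq_bigl => q; rewrite pF.
rewrite (eq_bigr _ split_lt) big_split /= swap -big_split big1 //= => p pF.
by rewrite -big_split big1 //= => q /andP[qF]; apply: t_anti.
Qed.

(** * Active pairs and admissibility *)

Section Active.
Variables (n d : nat).
Implicit Types (m : 'X_{1..n}) (p q r : 'I_n * 'I_d) (F : {set 'I_n * 'I_d}).

(* The pairs (i, 1 + a_1 + ... + a_i) with i < nu m, numbered from 0. *)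
Definition active m : {set 'I_n * 'I_d} :=
  [set p : 'I_n * 'I_d | psum m p.1.+1 == p.2 & (p.2 < mdeg m)%N].

Lemma activeP m p :
  reflect (psum m p.1.+1 = p.2 /\ (p.2 < mdeg m)%N) (p \in active m).
Proof. by rewrite inE; apply: (iffP andP) => -[/eqP]. Qed.

Lemma active_inj m : {in active m &, injective (fun p : 'I_n * 'I_d => p.1 : nat)}.
Proof.
move=> [i1 j1] [i2 j2] /activeP[/= e1 _] /activeP[/= e2 _] /val_inj i12.
by rewrite -i12 in e2 *; congr (_, _); apply: val_inj; rewrite /= -e1.
Qed.

(** Conditions (a) and (b) constrain the pairs one by one, and (b) makes the second index a function
    of the first. The admissible sets are thus the faces of a simplex, which is where the Koszul
    complex comes from. *)
Lemma admissibleE (k : fieldType) (I : {pred {mpoly k[n]}}) F m :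
  admissible I F m = mingen I m && (F \subset active m).
Proof.
rewrite /admissible; case: (mingen I m) => //=.
have activeE p : (p.1.+1 < nu m)%N &&
   (p.2.+1 == 1 + \sum_(l < n | (l <= p.1)%N) m l)%N = (p \in active m).
  rewrite inE ltn_nu add1n eqSS -[X in _ && (_ == X)]/(psum m p.1.+1) andbC eq_sym.
  by case: eqP => //= ->.
apply/andP/subsetP => [[_ /forall_inP h] p pF|h]; first by rewrite -activeE h.
split; last by apply/forall_inP => p pF; rewrite activeE h.
apply/dinjectiveP => p q pF qF pq; apply: (@active_inj m); rewrite ?h //.
by rewrite pq.
Qed.

End Active.

(** * Commutation and absorption of moves *)

Section Angle.
Variables (k : fieldType) (n d : nat) (I : {pred {mpoly k[n]}}).
Hypotheses (I_monomial : monomial_ideal I) (I_borel : borel_fixed I).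
Implicit Types (m : 'X_{1..n}) (p q r : 'I_n * 'I_d) (F : {set 'I_n * 'I_d}).
Local Notation angle := (angle I).
Local Notation active := (@active n d).

Lemma angle_active m p : mingen I m -> p \in active m ->
  [/\ mingen I (angle m p.1), (p.2 < mdeg (angle m p.1) <= mdeg m)%N &
      forall t, psum (angle m p.1) t =
        minn (if (t <= p.1)%N then psum m t else maxn (psum m t) p.2.+1)
             (mdeg (angle m p.1))].
Proof.
move=> gen_m /activeP[psum_p lt_p]; have lt_m := lt_p; rewrite -psum_p in lt_m.
have [gen_a lt_a le_a psum_a] := angleP I_monomial I_borel gen_m lt_m.
by split=> //; [rewrite -psum_p lt_a | move=> t; rewrite psum_a psum_p].
Qed.

(** The move at [q] changes no partial sum up to [q.1], and its cut falls after [q.2], which is at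
    least [p.2]. *)
Lemma active_angle_lt m p q : mingen I m -> p \in active m -> q \in active m ->
  (p.1 < q.1)%N -> p \in active (angle m q.1).
Proof.
move=> gen_m act_p act_q pq; have [_ /andP[lt_a _] psum_a] := angle_active gen_m act_q.
case/activeP: act_p act_q => psum_p lt_p /activeP[psum_q lt_q]; apply/activeP.
rewrite psum_a pq psum_p; have := psum_le m (leqW pq); lia.
Qed.

(** There are two ways for [q] to become inactive. If [p.2 = q.2], both moves take the same factor,
    and its stop at [q.1] leaves no trace. Otherwise [angle m p.1] is cut at or before position
    [q.2], where the move at [q] is not yet visible. *)
Lemma angle_absorb m p q : mingen I m -> p \in active m -> q \in active m ->
  (p.1 < q.1)%N -> q \notin active (angle m p.1) ->
  angle (angle m q.1) p.1 = angle m p.1.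
Proof.
move=> gen_m act_p act_q pq Nact.
have act_pq := active_angle_lt gen_m act_p act_q pq.
have [gen_a /andP[lt_a le_a] psum_a] := angle_active gen_m act_p.
have [gen_b /andP[lt_b le_b] psum_b] := angle_active gen_m act_q.
have [gen_c /andP[lt_c le_c] psum_c] := angle_active gen_b act_pq.
case/activeP: act_p act_q => psum_p lt_p /activeP[psum_q lt_q].
have pq_le := psum_le m (leqW pq).
move: Nact; rewrite inE negb_and psum_a [(_ <= p.1)%N]leqNgt leqW //= psum_q.
move=> Nact; have : (p.2 = q.2 :> nat) \/ (mdeg (angle m p.1) <= q.2)%N by lia.
case=> [p2q2|le_e].
  apply: (prefix_uniq (e1 := minn (mdeg (angle m q.1))
    (mdeg (angle (angle m q.1) p.1))) gen_c gen_a _ psum_a) => t.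
  rewrite psum_c psum_b; case: (leqP t p.1) => tp /=; first by rewrite ifT; lia.
  case: (leqP t q.1) => tq /=; last by lia.
  by have := psum_le m (leqW tq); have := psum_le m tp; lia.
apply: (prefix_uniq (e2 := mdeg (angle m p.1)) gen_c gen_a psum_c) => t.
rewrite psum_a psum_b; case: (leqP t p.1) => tp /=; first by rewrite ifT; lia.
case: (leqP t q.1) => tq /=; first by lia.
by have := psum_le m tq; lia.
Qed.

(** That [q] stays active forces [p.2 < q.2], so the two moves act on different factors. *)
Lemma angle_comm m p q : mingen I m -> p \in active m -> q \in active m ->
  (p.1 < q.1)%N -> q \in active (angle m p.1) ->
  angle (angle m q.1) p.1 = angle (angle m p.1) q.1.
Proof.
move=> gen_m act_p act_q pq act_qp.
have act_pq := active_angle_lt gen_m act_p act_q pq.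
have [gen_a /andP[lt_a le_a] psum_a] := angle_active gen_m act_p.
have [gen_b /andP[lt_b le_b] psum_b] := angle_active gen_m act_q.
have [gen_c /andP[lt_c le_c] psum_c] := angle_active gen_b act_pq.
have [gen_e /andP[lt_e le_e] psum_e] := angle_active gen_a act_qp.
case/activeP: act_p act_q => psum_p lt_p /activeP[psum_q lt_q].
case/activeP: act_qp => + lt_qa; rewrite psum_a ifN -?ltnNge ?ltnS ?(ltnW pq) //.
rewrite psum_q => max_q; have p2q2 : (p.2 < q.2)%N by lia.
(* [f] gives the partial sums after both moves and before any cut; successive cuts amount to one at
   the smaller length. *)
apply: (prefix_uniq (e1 := minn (mdeg (angle m q.1)) (mdeg (angle (angle m q.1) p.1)))
  (e2 := minn (mdeg (angle m p.1)) (mdeg (angle (angle m p.1) q.1)))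
  (f := fun t => if (t <= p.1)%N then psum m t else
      if (t <= q.1)%N then maxn (psum m t) p.2.+1 else maxn (psum m t) q.2.+1)
  gen_c gen_e) => t.
  rewrite psum_c psum_b; case: (leqP t p.1) => tp /=; first by rewrite ifT; lia.
  by case: (leqP t q.1) => tq /=; lia.
rewrite psum_e psum_a; case: (leqP t p.1) => tp /=; first by rewrite ifT; lia.
by case: (leqP t q.1) => tq /=; lia.
Qed.

(** For [r.1 > q.1]: as [r.2] lies before the cut of [angle m p.1], so does [q.2], and absorption
    must come from [p.2 = q.2]. Then [p.2 < r.2] says that the move at [q] leaves the partial sum of
    [r] unchanged, while [angle_absorb] compares the two cuts. *)
Lemma active_absorb m p q r : mingen I m -> p \in active m -> q \in active m ->
  (p.1 < q.1)%N -> q \notin active (angle m p.1) ->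
  r \in active m -> r \in active (angle m p.1) -> r \in active (angle m q.1).
Proof.
move=> gen_m act_p act_q pq Nact act_r act_rp.
have [rq|qr|rq] := ltngtP r.1 q.1; first exact: active_angle_lt.
  have absorb := angle_absorb gen_m act_p act_q pq Nact.
  have act_pq := active_angle_lt gen_m act_p act_q pq.
  have [gen_a /andP[lt_a le_a] psum_a] := angle_active gen_m act_p.
  have [gen_b /andP[lt_b le_b] psum_b] := angle_active gen_m act_q.
  have [_ /andP[_ +] _] := angle_active gen_b act_pq; rewrite absorb => le_ab.
  case/activeP: act_p act_q act_r => psum_p lt_p /activeP[psum_q lt_q].
  case/activeP=> psum_r lt_r; case/activeP: act_rp => + lt_ra.
  move: Nact; rewrite inE negb_and !psum_a !psum_q !psum_r => Nact psum_ra.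
  apply/activeP; rewrite psum_b psum_r; move: Nact psum_ra.
  have pr := ltn_trans pq qr; rewrite !ifN -?ltnNge ?ltnS ?(ltnW pq) ?(ltnW pr) ?(ltnW qr) //.
  have := psum_le m (leqW pq); have := psum_le m (leqW qr); lia.
by rewrite -(active_inj act_r act_q rq) act_rp in Nact.
Qed.

(** Before the cuts a move never lowers a partial sum, so if both moves together leave that of [r]
    fixed, each one does. The cut of the iterated move is no longer than either single cut. *)
Lemma active_comm m p q r : mingen I m -> p \in active m -> q \in active m ->
  (p.1 < q.1)%N -> q \in active (angle m p.1) ->
  r \in active m -> r \in active (angle (angle m p.1) q.1) ->
  r \in active (angle m p.1) /\ r \in active (angle m q.1).
Proof.
move=> gen_m act_p act_q pq act_qp act_r.
have act_pq := active_angle_lt gen_m act_p act_q pq.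
have [gen_a /andP[lt_a le_a] psum_a] := angle_active gen_m act_p.
have [gen_b /andP[lt_b le_b] psum_b] := angle_active gen_m act_q.
have [_ /andP[_ +] _] := angle_active gen_b act_pq.
have [gen_e /andP[lt_e le_e] psum_e] := angle_active gen_a act_qp.
rewrite angle_comm // => le_eb /activeP[+ lt_r].
case/activeP: act_p act_q act_r => psum_p lt_p /activeP[psum_q lt_q].
case/activeP=> psum_r _; case/activeP: act_qp => + _; rewrite psum_e !psum_a psum_q psum_r.
rewrite ifN -?ltnNge ?ltnS ?(ltnW pq) // => psum_qa psum_re.
split; apply/activeP; rewrite ?psum_a ?psum_b psum_r; move: psum_re;
  case: (leqP r.1.+1 q.1) => rq /=; case: (leqP r.1.+1 p.1) => rp /=; lia.
Qed.

(** Taking the factor next after [p.1] keeps the index sequence sorted: only the entry at position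
    [p.2] changes, to [p.1], and no other factor is shifted to a new second index. *)
Lemma bpol_angle_le m p : mingen I m -> p \in active m ->
  (bpol d (angle m p.1) <= U_(xvar p) + bpol d m)%MM.
Proof.
move=> gen_m act_p; have [_ /andP[lt_a le_a] psum_a] := angle_active gen_m act_p.
case/activeP: act_p => psum_p lt_p.
apply: mnm_xvarP => q; rewrite mnmDE mnm1E (inj_eq (@xvar_inj _ _)) !bpolE !psum_a.
case: (eqVneq p q) => [_|ne]; first by case: (_ <= _ < _)%N; lia.
have := psum_le m (leqnSn q.1).
case: (ltngtP q.1 p.1) => qp.
- by lia.
- by have := psum_le m qp; lia.
have eq1 : q.1 = p.1 by apply: val_inj.
rewrite eq1 psum_p.
have : q.2 <> p.2 :> nat.
  move/val_inj => eq2; case/eqP: ne.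
  by case: p q eq1 eq2 {qp lt_a le_a psum_a psum_p lt_p} => ? ? [? ?] /= -> ->.
lia.
Qed.

End Angle.

(** * Scalar coefficients of the differential *)

Section Incidence.
Variables (k : fieldType) (n d : nat) (I : {pred {mpoly k[n]}}).
Hypotheses (I_monomial : monomial_ideal I) (I_borel : borel_fixed I).
Implicit Types (m : 'X_{1..n}) (p q r : 'I_n * 'I_d) (F G : {set 'I_n * 'I_d}).
Local Notation T := {mpoly k[n * d]}.
Local Notation angle := (angle I).
Local Notation active := (@active n d).

(** The differential with its monomials erased. The second term carries no admissibility test,
    because [G] and [m'] are meant to come from an admissible pair, which a nonadmissible target
    never equals. *)
Definition incidence F m G m' : T :=
  \sum_(p in F) (-1) ^+ position F p *
    (((G == F :\ p) && (m' == m))%:R -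
     ((G == F :\ p) && (m' == angle m p.1))%:R).

Lemma incidence_neq0 F m G m' : incidence F m G m' != 0 ->
  exists2 p, p \in F & G = F :\ p /\ (m' = m \/ m' = angle m p.1).
Proof.
move=> nz; have [h|/pred0Pn[p /= /and3P[pF /eqP GF /orP mm]]] :=
  altP (@pred0P _ [pred p | [&& p \in F, G == F :\ p &
                       (m' == m) || (m' == angle m p.1)]]); last first.
  by exists p => //; split=> //; case: mm => /eqP; [left|right].
case/eqP: nz; rewrite /incidence big1 // => p pF.
move: (h p); rewrite /= pF; case: eqP => //= _ => [/negbT/norP[/negPf -> /negPf ->]|_];
  by rewrite subrr mulr0.
Qed.

Lemma incidence_swap F m G m' p q :
  mingen I m -> F \subset active m -> G \subset active m' ->
  p \in F -> q \in F -> (p.1 < q.1)%N -> G = F :\ p :\ q ->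
  let A p := (F :\ p \subset active (angle m p.1))%:R : T in
  (m' == m)%:R - (m' == angle m q.1)%:R
    - A p * ((m' == angle m p.1)%:R - (m' == angle (angle m p.1) q.1)%:R) =
  (m' == m)%:R - (m' == angle m p.1)%:R
    - A q * ((m' == angle m q.1)%:R - (m' == angle (angle m q.1) p.1)%:R).
Proof.
move=> gen_m /subsetP subF /subsetP subG pF qF pq defG A.
have [act_p act_q] := (subF p pF, subF q qF).
have ne_pq : p != q by apply: contraTneq pq => ->; rewrite ltnn.
have GP r : r \in G = [&& r != q, r != p & r \in F] by rewrite defG !inE.
have act_pq := active_angle_lt I_monomial I_borel gen_m act_p act_q pq.
have Aq_of : (forall r, r \in G -> r \in active (angle m q.1)) -> A q = 1.
  move=> h; rewrite /A (_ : _ \subset _) //; apply/subsetP => r.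
  rewrite !inE => /andP[rq rF]; case: (eqVneq r p) => [->|rp]; first by rewrite inE in act_pq.
  by have := h r; rewrite GP rq rp rF => /(_ isT); rewrite inE.
have m'q : m' = angle m q.1 -> A q = 1 by move=> m'E; apply: Aq_of; rewrite -m'E.
have [act_qp|Nact] := boolP (q \in active (angle m p.1)).
  have Ap_of : (forall r, r \in G -> r \in active (angle m p.1)) -> A p = 1.
    move=> h; rewrite /A (_ : _ \subset _) //; apply/subsetP => r.
    rewrite in_setD1 => /andP[rp rF]; case: (eqVneq r q) => [->|rq] //.
    by apply: h; rewrite GP rq rp rF.
  have m'p : m' = angle m p.1 -> A p = 1 by move=> m'E; apply: Ap_of; rewrite -m'E.
  have m'pq : m' = angle (angle m p.1) q.1 -> A p = 1 /\ A q = 1.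
    move=> m'E; split; [apply: Ap_of | apply: Aq_of] => r rG;
      have := subG r rG; have := rG; rewrite GP m'E => /and3P[_ _ rF];
      by case/(active_comm I_monomial I_borel gen_m act_p act_q pq act_qp (subF r rF)).
  rewrite (angle_comm I_monomial I_borel gen_m act_p act_q pq act_qp).
  case: (m' =P angle m q.1) m'q => [m'E1 /(_ m'E1) ->|_ _];
    case: (m' =P angle m p.1) m'p => [m'E2 /(_ m'E2) ->|_ _];
    (case: (m' =P angle (angle m p.1) q.1) m'pq => [m'E /(_ m'E) [Ap1 Aq1]|_ _];
     [rewrite ?Ap1 ?Aq1|]); ring.
have -> : A p = 0.
  rewrite /A (_ : _ \subset _ = false) //; apply/subsetP => /(_ q).
  by rewrite in_setD1 eq_sym ne_pq qF (negPf Nact) => /(_ isT).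
have m'p : m' = angle m p.1 -> A q = 1.
  move=> m'E; apply: Aq_of => r rG; have := subG r rG; have := rG.
  rewrite GP m'E => /and3P[_ _ rF].
  exact: (active_absorb I_monomial I_borel gen_m act_p act_q pq Nact (subF r rF)).
rewrite (angle_absorb I_monomial I_borel gen_m act_p act_q pq Nact).
case: (m' =P angle m q.1) m'q => [m'E /(_ m'E) ->|_ _]; first by ring.
by case: (m' =P angle m p.1) m'p => [m'E /(_ m'E) ->|_ _]; ring.
Qed.

Lemma incidence2 F m G m' :
  mingen I m -> F \subset active m -> G \subset active m' ->
  \sum_(p in F) (-1) ^+ position F p * (incidence (F :\ p) m G m' -
    (F :\ p \subset active (angle m p.1))%:R *
    incidence (F :\ p) (angle m p.1) G m') = 0.
Proof.
move=> gen_m subF subG.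
pose t p q : T := (-1) ^+ position F p * (-1) ^+ position (F :\ p) q *
  ((G == F :\ p :\ q)%:R * ((m' == m)%:R - (m' == angle m q.1)%:R
    - (F :\ p \subset active (angle m p.1))%:R *
      ((m' == angle m p.1)%:R - (m' == angle (angle m p.1) q.1)%:R))).
rewrite (eq_bigr (fun p => \sum_(q in F :\ p) t p q)) => [|p pF].
  apply: (sum_antisym (f := fun p : 'I_n * 'I_d => p.1 : nat)).
    by move=> p q pF qF; apply: (@active_inj n d m); apply: (subsetP subF).
  move=> p q pF qF pq; rewrite /t sign_position //; last first.
    by rewrite -val_eqE /=; lia.
  rewrite (_ : F :\ q :\ p = F :\ p :\ q); last by rewrite !setDDl setUC.
  case: eqP => [GF|_]; last by rewrite !mul0r !mulr0 addr0.
  by rewrite (incidence_swap gen_m subF subG) // !mul1r mulNr addNr.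
rewrite /incidence mulr_sumr -sumrB mulr_sumr; apply: eq_bigr => q _.
by rewrite /t; case: (G == _) => /=; ring.
Qed.
End Incidence.

Lemma mcoeff_XM (R : nzRingType) (n : nat) (a m : 'X_{1..n}) (f : {mpoly R[n]}) :
  ('X_[R, a] * f)@_m = if (a <= m)%MM then f@_(m - a)%MM else 0.
Proof.
rewrite -commr_mpolyX; case: ifP => [le|Nle].
  by rewrite -{1}(submK le) addmC mcoeffMX.
apply/eqP; rewrite mcoeff_eq0 (perm_mem (msuppMX f a)).
by apply/negP => /mapP[x _ mx]; rewrite mx lem_addr in Nle.
Qed.

(** * The complex property, the grading and minimality *)

Section Complex.
Variables (k : fieldType) (n d : nat) (I : {pred {mpoly k[n]}}).
Hypotheses (I_monomial : monomial_ideal I) (I_borel : borel_fixed I).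
Hypothesis I_deg : forall m : 'X_{1..n}, mingen I m -> (mdeg m <= d)%N.
Implicit Types (m : 'X_{1..n}) (p q r : 'I_n * 'I_d) (F G : {set 'I_n * 'I_d}).
Local Notation T := {mpoly k[n * d]}.
Local Notation angle := (angle I).
Local Notation active := (@active n d).
Local Notation incidence := (incidence I).

Lemma adm_pairP (q : nat) (b : adm_pair d I q) :
  [/\ mingen I (apm b), apF b \subset active (apm b) & #|apF b| = q].
Proof.
by have := valP b; rewrite admissibleE => /andP[/andP[gen_m subF] /eqP].
Qed.

Lemma adm_pair_inj (q : nat) (b c : adm_pair d I q) :
  apF b = apF c -> apm b = apm c -> b = c.
Proof.
move=> eqF eqm; apply: val_inj; apply/pair_eqP/andP; split; first exact/eqP.
exact/eqP/val_inj.
Qed.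

Lemma adm_pair_exists (q : nat) F m :
  mingen I m -> F \subset active m -> #|F| = q ->
  exists b : adm_pair d I q, apF b = F /\ apm b = m.
Proof.
move=> gen_m subF <-; have lt : (mdeg m < d.+1)%N by rewrite ltnS I_deg.
have adm : admissible I (F, BMultinom lt).1 (F, BMultinom lt).2 && (#|F| == #|F|).
  by rewrite admissibleE /= gen_m subF eqxx.
by exists (exist _ (F, BMultinom lt) adm).
Qed.

(** Replaces sums over the dependent basis by evaluation at any [(F, m)]; the indicator accounts for
    the pairs that index no basis element. *)
Lemma sum_adm_pair (q : nat) F m (f : {set 'I_n * 'I_d} -> 'X_{1..n} -> T) :
  mingen I m -> #|F| = q ->
  \sum_(b : adm_pair d I q) ((apF b == F) && (apm b == m))%:R * f (apF b) (apm b)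
  = (F \subset active m)%:R * f F m.
Proof.
move=> gen_m <-; have [subF|NsubF] := boolP (F \subset active m).
  have [b0 [F0 m0]] := adm_pair_exists gen_m subF (erefl _).
  rewrite (bigD1 b0) //= F0 m0 !eqxx big1 ?addr0 // => b /negP ne.
  case: eqP => [Fb|]; last by rewrite mul0r.
  case: eqP => [mb|]; last by rewrite mul0r.
  by case: ne; apply/eqP/adm_pair_inj; rewrite ?Fb ?mb.
rewrite mul0r big1 // => b _; case: eqP => [Fb|]; last by rewrite mul0r.
case: eqP => [mb|]; last by rewrite mul0r.
by case: (adm_pairP b); rewrite Fb mb (negPf NsubF).
Qed.

Definition Pexp (q : nat) : Pgens d I q -> 'X_{1..n * d} :=
  match q return Pgens d I q -> 'X_{1..n * d} with
  | 0 => fun=> 0%MM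
  | q'.+1 => fun b : adm_pair d I q' => (bpol d (apm b) + \sum_(p in apF b) U_(xvar p))%MM
  end.

Definition Psign (q : nat) : Pgens d I q.+1 -> Pgens d I q -> T :=
  match q return Pgens d I q.+1 -> Pgens d I q -> T with
  | 0 => fun _ _ => 1
  | q'.+1 => fun (b : adm_pair d I q'.+1) (c : adm_pair d I q') =>
      incidence (apF b) (apm b) (apF c) (apm c)
  end.

Lemma multidegD (a b : 'X_{1..n * d}) :
  multideg (a + b)%MM = multideg a + multideg b.
Proof. by apply/matrixP => i j; rewrite !mxE mnmDE PoszD. Qed.

Lemma PdegE (q : nat) (b : Pgens d I q) : Pdeg b = multideg (Pexp b).
Proof.
by case: q b => //= b; apply/matrixP => i j; rewrite !mxE mnm0E.
Qed.

(* Up to a sign, an entry of the differential is a monomial determined by the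
   degrees, so the square of the differential vanishes if that of Psign does. *)
Lemma PdgenE (q : nat) (b : Pgens d I q.+1) (c : Pgens d I q) :
  Pdgen b c = 'X_[k, (Pexp b - Pexp c)%MM] * Psign b c.
Proof.
case: q b c => [|q] b c /=; first by rewrite ffunE subm0 mulr1;
  case: (adm_pairP b) => _ _ /eqP; rewrite cards_eq0 => /eqP ->; rewrite big_set0 addm0.
rewrite ffunE /incidence mulr_sumr.
have -> : \sum_(p in apF b | admissible I (apF b :\ p) (angle (apm b) p.1))
     (-1) ^+ position (apF b) p
     * 'X_[k, (U_(xvar p) + bpol d (apm b) - bpol d (angle (apm b) p.1))%MM]
     * Pelt I q (apF b :\ p) (angle (apm b) p.1) c =
  \sum_(p in apF b) (-1) ^+ position (apF b) p
     * 'X_[k, (U_(xvar p) + bpol d (apm b) - bpol d (angle (apm b) p.1))%MM]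
     * Pelt I q (apF b :\ p) (angle (apm b) p.1) c.
  rewrite [RHS](bigID (fun p => admissible I (apF b :\ p) (angle (apm b) p.1))) /=.
  rewrite [X in _ = _ + X]big1 ?addr0 // => p /andP[_ /negP Nadm].
  rewrite ffunE; case: eqP => [Fc|]; last by rewrite mulr0.
  case: eqP => [mc|]; last by rewrite mulr0.
  case: Nadm; rewrite -Fc -mc admissibleE.
  by case: (adm_pairP c) => -> ->.
rewrite -sumrB; apply: eq_bigr => p pF; rewrite !ffunE.
have expF : (\sum_(q in apF b) U_(xvar q) =
    U_(xvar p) + \sum_(q in apF b :\ p) U_(xvar q))%MM.
  by rewrite (bigD1 p) //=; congr (_ + _)%MM; apply: eq_bigl => q'; rewrite !inE andbC.
case: (eqVneq (apF c) (apF b :\ p)) => [Fc|_] /=; last by rewrite !mulr0 subrr !mulr0.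
rewrite Fc expF.
have subA (x y z : 'X_{1..n * d}) : (x + z - (y + z) = x - y)%MM.
  by apply/mnmP => i; rewrite !(mnmBE, mnmDE); lia.
rewrite [(U_(xvar p) + bpol _ _)%MM]addmC addmA subA.
set e := (bpol d (apm b) + U_(xvar p))%MM.
have -> : (-1) ^+ position (apF b) p * 'X_(xvar p) * (apm c == apm b)%:R =
    (-1) ^+ position (apF b) p * 'X_[k, (e - bpol d (apm c))%MM]
      * (apm c == apm b)%:R :> T.
  by case: (apm c =P apm b) => [->|]; rewrite ?mulr0 // /e addmC addmK.
have -> : (-1) ^+ position (apF b) p * 'X_[k, (e - bpol d (angle (apm b) p.1))%MM]
      * (apm c == angle (apm b) p.1)%:R =
    (-1) ^+ position (apF b) p * 'X_[k, (e - bpol d (apm c))%MM]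
      * (apm c == angle (apm b) p.1)%:R :> T.
  by case: (apm c =P angle _ _) => [->|]; rewrite ?mulr0.
ring.
Qed.

Lemma Psign_le (q : nat) (b : Pgens d I q.+1) (c : Pgens d I q) :
  Psign b c != 0 -> (Pexp c <= Pexp b)%MM.
Proof.
case: q b c => [|q] b c /=; first by move=> _; apply/mnm_lepP => i; rewrite mnm0E.
have [gen_m /subsetP subF _] := adm_pairP b.
case/incidence_neq0 => p pF [Fc mc].
have -> : (\sum_(q in apF b) U_(xvar q) = U_(xvar p) + \sum_(q in apF c) U_(xvar q))%MM.
  rewrite (bigD1 p) //=; congr (_ + _)%MM.
  by apply: eq_bigl => q'; rewrite Fc !inE andbC.
rewrite addmA; suff /mnm_lepP le_e : (bpol d (apm c) <= bpol d (apm b) + U_(xvar p))%MM.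
  by apply/mnm_lepP => i; rewrite ![(_ + \sum_(_ in _) _)%MM i]mnmDE leq_add2r.
case: mc => ->; first exact: lem_addr.
by rewrite addmC; apply: bpol_angle_le => //; apply: subF.
Qed.

(** For [I = S] the generator 1 would give a unit entry in the first differential. In higher degrees
    an entry is either a variable or a quotient still containing the polarized variable of the
    factor at position [p.2], which the move replaced. *)
Lemma Psign_neq (q : nat) (b : Pgens d I q.+1) (c : Pgens d I q) :
  1 \notin I -> Psign b c != 0 -> Pexp b != Pexp c.
Proof.
move=> N1; case: q b c => [|q] b c /=.
  have [gen_m _ /eqP] := adm_pairP b; rewrite cards_eq0 => /eqP -> _.
  rewrite big_set0 addm0; apply/eqP => bpol0.
  have deg_m : (0 < mdeg (apm b))%N.
    rewrite lt0n mdeg_eq0; apply: contraNneq N1 => m0; rewrite -mpolyX0 -m0.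
    by case/mingenP: gen_m.
  have [i hi] := psum_find deg_m.
  have d0 : (0 < d)%N := leq_trans deg_m (I_deg gen_m).
  have := bpolE (apm b) (i, Ordinal d0); rewrite bpol0 mnm0E /=.
  by rewrite hi.
have [gen_m /subsetP subF _] := adm_pairP b.
case/incidence_neq0 => p pF [Fc mc].
have -> : (\sum_(q in apF b) U_(xvar q) = U_(xvar p) + \sum_(q in apF c) U_(xvar q))%MM.
  rewrite (bigD1 p) //=; congr (_ + _)%MM.
  by apply: eq_bigl => q'; rewrite Fc !inE andbC.
rewrite addmA; apply/eqP.
move=> /(congr1 (fun x : 'X_{1..n * d} => x - \sum_(q in apF c) U_(xvar q))%MM).
rewrite !addmK; case: mc => -> /mnmP eq_bc.
  by have := eq_bc (xvar p); rewrite mnmDE mnm1E eqxx; lia.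
have [_ /andP[lt_a _] psum_a] := angle_active I_monomial I_borel gen_m (subF p pF).
have /activeP[psum_p lt_p] := subF p pF.
have [i /andP[le_i lt_i]] := psum_find lt_p.
have := eq_bc (xvar (i, p.2)); rewrite mnmDE !bpolE /= le_i lt_i psum_a.
have pi : (p.1 < i)%N.
  by rewrite ltnNge -ltnS; apply/negP => /(psum_le (apm b)); rewrite psum_p leqNgt lt_i.
rewrite [(i <= _)%N]leqNgt pi /=; lia.
Qed.

Lemma sum_incidence (q : nat) F m (g : {set 'I_n * 'I_d} -> 'X_{1..n} -> T) :
  mingen I m -> F \subset active m -> #|F| = q.+1 ->
  \sum_(b : adm_pair d I q) incidence F m (apF b) (apm b) * g (apF b) (apm b) =
  \sum_(p in F) (-1) ^+ position F p * (g (F :\ p) m -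
    (F :\ p \subset active (angle m p.1))%:R * g (F :\ p) (angle m p.1)).
Proof.
move=> gen_m subF cardF.
under eq_bigr do rewrite /incidence mulr_suml.
rewrite exchange_big; apply: eq_bigr => p pF /=.
under eq_bigr do rewrite -mulrA mulrBl.
rewrite -mulr_sumr sumrB; congr (_ * _).
have cardFp : #|F :\ p| = q by move: cardF; rewrite (cardsD1 p) pF add1n => -[].
have act_p := subsetP subF p pF.
have [gen_a _ _] := angle_active I_monomial I_borel gen_m act_p.
rewrite !sum_adm_pair //.
by rewrite (subset_trans (subD1set _ _) subF) mul1r.
Qed.

Lemma Psign2 (q : nat) (b : Pgens d I q.+2) (c : Pgens d I q) :
  \sum_(a : Pgens d I q.+1) Psign b a * Psign a c = 0.
Proof.
have [gen_m subF cardF] := adm_pairP b.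
case: q b c gen_m subF cardF => [|q] b c gen_m subF cardF /=.
  (* Onto [P_0] every generator contributes 1, and the empty set is admissible for [angle m p.1], so
     the two terms cancel. *)
  rewrite (sum_incidence (fun _ _ => 1)) //.
  have /cards1P[p defF] : #|apF b| == 1%N by rewrite cardF.
  by rewrite defF big_set1 setDv sub0set mul1r subrr mulr0.
rewrite (sum_incidence (fun F m => incidence F m (apF c) (apm c))) //.
by apply: incidence2 => //; have [] := adm_pairP c.
Qed.

Lemma cdgen2 (q : nat) (b : Pgens d I q.+2) (c : Pgens d I q) :
  \sum_(a : Pgens d I q.+1) Pdgen b a * Pdgen a c = 0.
Proof.
rewrite (eq_bigr (fun a => 'X_[k, (Pexp b - Pexp c)%MM] *
    (Psign b a * Psign a c))) => [|a _]; first by rewrite -mulr_sumr Psign2 mulr0.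
rewrite !PdgenE mulrACA.
have [->|ba] := eqVneq (Psign b a) 0; first by rewrite !mul0r !mulr0.
have [->|ac] := eqVneq (Psign a c) 0; first by rewrite !mulr0.
rewrite -mpolyXD; congr ('X_[_] * _).
apply/mnmP => i; rewrite mnmDE !mnmBE.
have /mnm_lepP/(_ i) := Psign_le ba; have /mnm_lepP/(_ i) := Psign_le ac; lia.
Qed.

Lemma Psign_const (q : nat) (b : Pgens d I q.+1) (c : Pgens d I q) :
  exists s : k, Psign b c = s%:MP.
Proof.
case: q b c => [|q] b c; first by exists 1.
exists (\sum_(p in apF b) (-1) ^+ position (apF b) p *
    (((apF c == apF b :\ p) && (apm c == apm b))%:R -
     ((apF c == apF b :\ p) && (apm c == angle (apm b) p.1))%:R)).
rewrite rmorph_sum; apply: eq_bigr => p _.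
by rewrite rmorphM rmorphXn rmorphN1 rmorphB !rmorph_nat.
Qed.

Local Notation P := (Ptilde d I).

Lemma Ptilde_is_complex : is_complex P.
Proof.
move=> q v; apply/ffunP => c; rewrite !ffunE.
under eq_bigr do rewrite ffunE mulr_suml.
rewrite exchange_big big1 //= => b _.
under eq_bigr do rewrite -mulrA.
by rewrite -mulr_sumr (cdgen2 b c) mulr0.
Qed.

Lemma Ptilde_graded : graded P.
Proof.
move=> q delta v v_hom c m; rewrite ffunE mcoeff_msupp raddf_sum /= => nz.
have [b nz_b] : exists b, (v b * Pdgen b c)@_m != 0.
  apply/existsP; apply: contraNT nz; rewrite negb_exists => /forallP h.
  by rewrite big1 // => b _; apply/eqP/negPn.
move: nz_b; rewrite PdgenE mulrCA mcoeff_XM; case: ifP => [le_m|_]; last by rewrite eqxx.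
have [->|bc] := eqVneq (Psign b c) 0; first by rewrite mulr0 mcoeff0 eqxx.
have [s ->] := Psign_const b c; rewrite mulrC mcoeffCM mulf_eq0 => /norP[_ nz_v].
rewrite /= PdegE -multidegD -(submK le_m) -addmA submK ?Psign_le //.
by rewrite multidegD -PdegE; apply: v_hom; rewrite mcoeff_msupp.
Qed.

Lemma Ptilde_minimal : 1 \notin I -> minimal P.
Proof.
move=> N1 q v c; rewrite ffunE; apply: ideal_gen_sum => b; apply: ideal_genM.
rewrite [cdgen _ _]PdgenE; have [->|bc] := eqVneq (Psign b c) 0.
  by rewrite mulr0; apply: ideal_gen0.
rewrite mulrC; apply: ideal_genM.
have [l lt_l] := mnmle_ltn (Psign_le bc) (contra_neq esym (Psign_neq N1 bc)).
have le_l : (U_(l) <= Pexp b - Pexp c)%MM.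
  by apply/mnm_lepP => i; rewrite mnm1E mnmBE; case: eqP => // <-; lia.
rewrite -(submK le_l) mpolyXD; apply: ideal_genM; apply: ideal_gen_sub.
by exists l.
Qed.

End Complex.

(** * Acyclicity *)

Section Quotient.
Variables (R : nzRingType) (N : nat).
Implicit Types (f g : {mpoly R[N]}) (i j : 'I_N) (m : 'X_{1..N}).

(** Division by ['X_i] that discards the monomials not divisible by it; it vanishes exactly on the
    polynomials free of ['X_i]. *)
Definition mquo i f : {mpoly R[N]} :=
  \sum_(m <- msupp f | (0 < m i)%N) f@_m *: 'X_[(m - U_(i))%MM].

Lemma mcoeff_mquo i f m : (mquo i f)@_m = f@_(m + U_(i))%MM.
Proof.
rewrite raddf_sum /=.
have subU (x : 'X_{1..N}) : (0 < x i)%N -> ((x - U_(i))%MM == m) = (x == (m + U_(i))%MM).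
  move=> xi; apply/eqP/eqP => [<-|->]; last by rewrite addmK.
  by rewrite submK //; apply/mnm_lepP => j; rewrite mnm1E; case: eqP => // <-.
have [supp|] := boolP ((m + U_(i))%MM \in msupp f).
  rewrite (big_rem _ supp) /= mnmDE mnm1E eqxx addn1 /= addmK mcoeffZ mcoeffX.
  rewrite eqxx mulr1 big_seq_cond big1 ?addr0 // => x.
  rewrite (mem_rem_uniq _ (msupp_uniq f)) inE => /andP[/andP[ne _] xi].
  by rewrite mcoeffZ mcoeffX subU // (negPf ne) mulr0.
move=> Nsupp; rewrite (memN_msupp_eq0 Nsupp) big_seq_cond big1 // => x.
case/andP=> xs xi; rewrite mcoeffZ mcoeffX subU //; case: eqP => [xm|].
  by rewrite xm (negPf Nsupp) in xs.
by rewrite mulr0.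
Qed.

Lemma mquo0 i : mquo i 0 = 0.
Proof. by apply/mpolyP => m; rewrite mcoeff_mquo !mcoeff0. Qed.

Lemma mquoD i f g : mquo i (f + g) = mquo i f + mquo i g.
Proof. by apply/mpolyP => m; rewrite mcoeffD !mcoeff_mquo mcoeffD. Qed.

Lemma mquoN i f : mquo i (- f) = - mquo i f.
Proof. by apply/mpolyP => m; rewrite mcoeffN !mcoeff_mquo mcoeffN. Qed.

Lemma mquo_sign i s f : mquo i ((-1) ^+ s * f) = (-1) ^+ s * mquo i f.
Proof.
rewrite -signr_odd; case: (odd s); last by rewrite !expr0 !mul1r.
by rewrite !expr1 !mulN1r mquoN.
Qed.

Lemma mquo_sum (J : finType) (P : pred J) i (f : J -> {mpoly R[N]}) :
  mquo i (\sum_(j | P j) f j) = \sum_(j | P j) mquo i (f j).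
Proof. exact: (big_morph _ (mquoD i) (mquo0 i)). Qed.

Lemma mquoX i f : mquo i ('X_i * f) = f.
Proof.
by apply/mpolyP => m; rewrite mcoeff_mquo mcoeff_XM lem_addl addmK.
Qed.

Lemma mquo_X i j f : i != j -> mquo i ('X_j * f) = 'X_j * mquo i f.
Proof.
move=> ij; apply/mpolyP => m; rewrite mcoeff_mquo !mcoeff_XM mcoeff_mquo.
have -> : (U_(j) <= m + U_(i))%MM = (U_(j) <= m)%MM.
  apply/mnm_lepP/mnm_lepP => h x; have := h x; rewrite ?mnmDE !mnm1E; last by lia.
  by case: (eqVneq j x) => [<-|]; rewrite ?(negPf ij); lia.
case: ifP => // le; congr (_@__); apply/mnmP => x.
have := mnm_lepP le x; rewrite !(mnmBE, mnmDE); lia.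
Qed.

Lemma mquoC i j f : mquo i (mquo j f) = mquo j (mquo i f).
Proof. by apply/mpolyP => m; rewrite !mcoeff_mquo -!addmA [(U_(j) + _)%MM]addmC. Qed.

End Quotient.

(** * Lexicographic order and rank *)

Section LexOrder.
Variable n : nat.
Implicit Types m : 'X_{1..n}.

Definition lexlt m1 m2 : bool :=
  [exists i : 'I_n, (m1 i < m2 i)%N &&
     [forall j : 'I_n, (j < i)%N ==> (m1 j == m2 j)]].

Lemma lexltP m1 m2 : reflect
  (exists2 i : 'I_n, (m1 i < m2 i)%N & forall j : 'I_n, (j < i)%N -> m1 j = m2 j)
  (lexlt m1 m2).
Proof.
apply: (iffP existsP) => [[i /andP[lt /forallP h]]|[i lt h]]; exists i => //.
  by move=> j ji; have := h j; rewrite ji => /eqP.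
by rewrite lt; apply/forallP => j; apply/implyP => /h ->.
Qed.

Lemma lexlt_irr m : lexlt m m = false.
Proof. by apply/lexltP => -[i]; rewrite ltnn. Qed.

Lemma lexlt_trans m1 m2 m3 : lexlt m1 m2 -> lexlt m2 m3 -> lexlt m1 m3.
Proof.
move=> /lexltP[i lt_i eq_i] /lexltP[j lt_j eq_j]; apply/lexltP.
case: (ltngtP i j) => ij.
- exists i => [|x xi]; first by rewrite -eq_j.
  by rewrite eq_i // eq_j // (ltn_trans xi).
- exists j => [|x xj]; first by rewrite eq_i.
  by rewrite eq_i ?eq_j // (ltn_trans xj).
move/val_inj: ij => ij; subst j; exists i; first exact: ltn_trans lt_j.
by move=> x xi; rewrite eq_i // eq_j.
Qed.

Lemma lexlt_total m1 m2 : m1 != m2 -> lexlt m1 m2 || lexlt m2 m1.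
Proof.
move=> ne; have /existsP[i0 ne_i0] : [exists i, m1 i != m2 i].
  apply: contraR ne; rewrite negb_exists => /forallP h.
  by apply/eqP/mnmP => i; apply/eqP/negPn.
have [i ne_i min_i] := @arg_minnP _ i0 (fun i => m1 i != m2 i) val ne_i0.
have eq_i (j : 'I_n) : (j < i)%N -> m1 j = m2 j.
  by move=> ji; apply/eqP/negPn/negP => /min_i; rewrite leqNgt ji.
case: (ltngtP (m1 i) (m2 i)) ne_i => // lt _; apply/orP; [left|right].
  by apply/lexltP; exists i.
by apply/lexltP; exists i => // j /eq_i.
Qed.

Variable d : nat.

(** Turns the decreasing lexicographic order into an order on [nat], which indexes the filtration
    and supports induction; larger monomials have smaller rank. *)
Definition lexrank m : nat := #|[set x : 'X_{1..n < d.+1} | lexlt m x]|.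

Lemma lexrank_lt m1 m2 :
  (mdeg m2 <= d)%N -> lexlt m1 m2 -> (lexrank m2 < lexrank m1)%N.
Proof.
rewrite -ltnS => deg2 lt12; apply/proper_card/properP; split.
  by apply/subsetP => x; rewrite !inE; apply: lexlt_trans.
by exists (BMultinom deg2); rewrite !inE /= ?lexlt_irr.
Qed.

Lemma lexrank_inj m1 m2 : (mdeg m1 <= d)%N -> (mdeg m2 <= d)%N ->
  lexrank m1 = lexrank m2 -> m1 = m2.
Proof.
move=> deg1 deg2 eq_rank; apply/eqP/negPn/negP => /lexlt_total /orP[] lt.
  by have := lexrank_lt deg2 lt; rewrite eq_rank ltnn.
by have := lexrank_lt deg1 lt; rewrite eq_rank ltnn.
Qed.

End LexOrder.

(** * The filtration and the Koszul contraction *)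

Section Acyclicity.
Variables (k : fieldType) (n d : nat) (I : {pred {mpoly k[n]}}).
Hypotheses (I_monomial : monomial_ideal I) (I_borel : borel_fixed I).
Hypothesis I_deg : forall m : 'X_{1..n}, mingen I m -> (mdeg m <= d)%N.
Implicit Types (m : 'X_{1..n}) (p : 'I_n * 'I_d) (F G : {set 'I_n * 'I_d}).
Local Notation T := {mpoly k[n * d]}.
Local Notation angle := (angle I).
Local Notation active := (@active n d).
Local Notation rank := (lexrank d).
Local Notation P := (Ptilde d I).
Local Notation sgn F p := ((-1) ^+ position F p).

Lemma cdiffD (q : nat) (v w : cmod P q.+1) : cdiff (v + w) = cdiff v + cdiff w.
Proof.
apply/ffunP => c; rewrite !ffunE -big_split; apply: eq_bigr => b _ /=.
by rewrite ffunE mulrDl.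
Qed.

Lemma cdiffN (q : nat) (v : cmod P q.+1) : cdiff (- v) = - cdiff v.
Proof.
apply/ffunP => c; rewrite !ffunE -sumrN; apply: eq_bigr => b _ /=.
by rewrite ffunE mulNr.
Qed.

Lemma angle_lexlt m p : mingen I m -> p \in active m -> lexlt m (angle m p.1).
Proof.
move=> gen_m act_p.
have [_ /andP[lt_a _] psum_a] := angle_active I_monomial I_borel gen_m act_p.
have /activeP[psum_p lt_p] := act_p.
have psum_low t : (t <= p.1)%N -> psum (angle m p.1) t = psum m t.
  by move=> tp; rewrite psum_a tp; have := psum_le m (leqW tp); lia.
apply/lexltP; exists p.1 => [|j jp].
  have := psumS (angle m p.1) p.1; have := psumS m p.1.
  by rewrite (psum_low p.1) // psum_a ltnn; lia.
have := psumS (angle m p.1) j; have := psumS m j.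
by rewrite (psum_low j (ltnW jp)) (psum_low j.+1 jp) => -> /addnI.
Qed.

Lemma rank_angle m p : mingen I m -> p \in active m ->
  (rank (angle m p.1) < rank m)%N.
Proof.
move=> gen_m act_p; apply: lexrank_lt; last exact: angle_lexlt.
by have [/I_deg] := angle_active I_monomial I_borel gen_m act_p.
Qed.

(** Extension of [v] by zero to the pairs that index no basis element, so that sets such as [F :\ p]
    or [p |: F] serve as coordinates without a proof of admissibility. *)
Definition coord (q : nat) (v : cmod P q.+1) F m : T :=
  \sum_(b : adm_pair d I q) ((apF b == F) && (apm b == m))%:R * v b.

Lemma coordE (q : nat) (v : cmod P q.+1) (b : adm_pair d I q) :
  coord v (apF b) (apm b) = v b.
Proof.
rewrite /coord (bigD1 b) //= !eqxx mul1r big1 ?addr0 // => c ne.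
case: eqP => [eqF|_]; last by rewrite mul0r.
case: eqP => [eqm|_]; last by rewrite mul0r.
by rewrite (adm_pair_inj eqF eqm) eqxx in ne.
Qed.

Lemma coord_mk (q : nat) F m (g : {set 'I_n * 'I_d} -> 'X_{1..n} -> T) :
  mingen I m -> F \subset active m -> #|F| = q ->
  coord ([ffun b : adm_pair d I q => g (apF b) (apm b)] : cmod P q.+1) F m = g F m.
Proof.
move=> gen_m subF cardF; rewrite /coord.
under eq_bigr do rewrite ffunE.
by rewrite sum_adm_pair // subF mul1r.
Qed.

Definition rank_below (q r : nat) (v : cmod P q.+1) :=
  forall b : adm_pair d I q, v b != 0 -> (rank (apm b) < r)%N.

Lemma Pdgen_rank (q : nat) (b : adm_pair d I q.+1) (c : adm_pair d I q) :
  Pdgen (b : Pgens d I q.+2) (c : Pgens d I q.+1) != 0 ->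
  apm c = apm b \/ (rank (apm c) < rank (apm b))%N.
Proof.
rewrite PdgenE // => nz.
have /incidence_neq0[p pF [_ []]] : Psign (b : Pgens d I q.+2) (c : Pgens d I q.+1) != 0.
- by apply: contraNneq nz => ->; rewrite mulr0.
- by left.
move=> ->; right; have [gen_m /subsetP subF _] := adm_pairP b.
by apply: rank_angle => //; apply: subF.
Qed.

(* Only the Koszul part of the differential reaches the generators of maximal rank. *)
Lemma cdiff_top (q : nat) (v : cmod P q.+2) (c : adm_pair d I q) :
  rank_below (rank (apm c)).+1 v ->
  cdiff v c = \sum_(p in active (apm c) :\: apF c)
    sgn (p |: apF c) p * 'X_(xvar p) * coord v (p |: apF c) (apm c).
Proof.
move=> below; rewrite ffunE.
rewrite /coord.
under [RHS]eq_bigr do rewrite mulr_sumr.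
rewrite exchange_big; apply: eq_bigr => b _ /=.
have [->|nz_b] := eqVneq (v b) 0.
  by rewrite mul0r big1 // => p _; rewrite !mulr0.
have [gen_b /subsetP sub_b _] := adm_pairP b.
rewrite ffunE; rewrite [X in _ - X]big1 ?subr0; last first.
  move=> p /andP[pF _]; rewrite ffunE; case: (apm c =P angle _ _) => [mc|_].
    have := below b nz_b; rewrite ltnS leqNgt mc rank_angle //.
    exact: sub_b.
  by rewrite andbF mulr0.
rewrite mulr_sumr; rewrite big_mkcond [RHS]big_mkcond; apply: eq_bigr => p _.
rewrite ffunE in_setD; case: (eqVneq (apm c) (apm b)) => [mc|ne] /=; last first.
  by rewrite !andbF !(mulr0, mul0r) !if_same.
rewrite mc !andbT.
have [Fb|neF] := eqVneq (apF b) (p |: apF c).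
  have [pc|pc] := boolP (p \in apF c) => /=.
    case: ifP => // pb; case: eqP => [Fc|]; last by rewrite !mulr0.
    by move: pc; rewrite Fc !inE eqxx.
  have pb : p \in apF b by rewrite Fb setU11.
  rewrite pb sub_b // -Fb.
  have -> : apF c == apF b :\ p by rewrite Fb setU1K.
  by rewrite !mulr1 mul1r mulrC.
rewrite mul0r mulr0; case: ifP => pb; last by rewrite if_same.
case: eqP => [Fc|]; last by rewrite !mulr0 if_same.
by rewrite Fc setD1K // eqxx in neF.
Qed.

Lemma rank_belowB (q r : nat) (v w : cmod P q.+1) :
  rank_below r v -> rank_below r w -> rank_below r (v - w).
Proof.
move=> bv bw b; rewrite !ffunE; have [v0|/bv //] := eqVneq (v b) 0.
by rewrite v0 sub0r oppr_eq0 => /bw.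
Qed.

Lemma rank_below_cdiff (q r : nat) (u : cmod P q.+2) :
  rank_below r u -> rank_below r (cdiff u).
Proof.
move=> bu c; rewrite ffunE => nz.
have [b] : exists b, u b * Pdgen (b : Pgens d I q.+2) (c : Pgens d I q.+1) != 0.
  apply/existsP; apply: contraNT nz; rewrite negb_exists => /forallP h.
  by rewrite big1 // => b _; apply/eqP/negPn.
rewrite mulf_eq0 => /norP[/bu lt_b /Pdgen_rank [-> //|lt_c]].
exact: ltn_trans lt_b.
Qed.

(* [mquo x_p], inserted at the position of p, contracts the Koszul complex onto
   the elements that involve neither p nor the variable x_p. *)
Definition contraction (q : nat) (v : cmod P q.+1) m p : cmod P q.+2 :=
  [ffun b : adm_pair d I q.+1 =>
     if (apm b == m) && (p \in apF b)
     then sgn (apF b) p * mquo (xvar p) (coord v (apF b :\ p) m) else 0].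

Lemma coord_contraction (q : nat) (v : cmod P q.+1) F m p :
  mingen I m -> F \subset active m -> #|F| = q.+1 ->
  coord (contraction v m p) F m =
    if p \in F then sgn F p * mquo (xvar p) (coord v (F :\ p) m) else 0.
Proof.
move=> gen_m subF cardF; rewrite /contraction.
rewrite (coord_mk (fun F' m' => if (m' == m) && (p \in F')
  then sgn F' p * mquo (xvar p) (coord v (F' :\ p) m) else 0)) //.
by rewrite eqxx.
Qed.

Lemma rank_below_contraction (q : nat) (v : cmod P q.+1) m p :
  rank_below (rank m).+1 (contraction v m p).
Proof.
by move=> b; rewrite ffunE; case: (apm b =P m) => [->|]; rewrite ?eqxx.
Qed.

(** Among the sets [p' |: apF c] only the one with [p' = p] contains [p], and its sign occurs
    twice. *)
Lemma contraction_notin (q : nat) (v : cmod P q.+1) p (c : adm_pair d I q) :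
  p \in active (apm c) -> p \notin apF c ->
  cdiff (contraction v (apm c) p) c = 'X_(xvar p) * mquo (xvar p) (v c).
Proof.
move=> act_p pc; have [gen_c sub_c card_c] := adm_pairP c.
rewrite cdiff_top; last exact: rank_below_contraction.
have coord_u p' : p' \in active (apm c) :\: apF c ->
    coord (contraction v (apm c) p) (p' |: apF c) (apm c) =
    if p == p' then sgn (p |: apF c) p * mquo (xvar p) (v c) else 0.
  rewrite in_setD => /andP[p'c act_p']; rewrite coord_contraction //.
  - rewrite in_setU1 (negPf pc) orbF; case: eqP => // <-.
    by rewrite setU1K // coordE.
  - by rewrite subUset sub1set act_p'.
  by rewrite cardsU1 p'c card_c.
rewrite (bigD1 p) ?in_setD ?pc //= coord_u ?in_setD ?pc // eqxx.
rewrite big1 ?addr0 => [|p' /andP[p'c ne]]; last first.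
  by rewrite coord_u // eq_sym (negPf ne) mulr0.
rewrite mulrACA [_ * sgn _ _]mulrC; rewrite -exprD addnn -mul2n exprM sqrrN.
by rewrite !expr1n mul1r.
Qed.

(** The homotopy identity [dh + hd = id] at a set containing [p], evaluated on a cycle. *)
Lemma contraction_in (q : nat) (v : cmod P q.+1) p (c : adm_pair d I q) :
  p \in apF c -> cdiff v = 0 -> rank_below (rank (apm c)).+1 v ->
  cdiff (contraction v (apm c) p) c = v c.
Proof.
move=> pc cyc bv; have [gen_c sub_c card_c] := adm_pairP c.
have act_p := subsetP sub_c p pc.
rewrite cdiff_top; last exact: rank_below_contraction.
case: q => [|q] in v c pc cyc bv gen_c sub_c card_c act_p *.
  by move/eqP: card_c; rewrite cards_eq0 => /eqP c0; rewrite c0 inE in pc.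
have sub_cp : apF c :\ p \subset active (apm c) by rewrite (subset_trans (subD1set _ _)).
have card_cp : #|apF c :\ p| = q by move: card_c; rewrite (cardsD1 p) pc add1n => -[].
have [c' [Fc' mc']] := adm_pair_exists I_deg gen_c sub_cp card_cp.
(* In the cycle equation at [apF c :\ p], division by the variable of [p] turns the term of [p] into
   [v c] up to sign, which expresses [v c] through the other coordinates. *)
have := congr1 (fun w : cmod P q.+1 => mquo (xvar p) (w c')) cyc.
rewrite /= cdiff_top ?mc' // ffunE mquo0 mquo_sum Fc'.
rewrite (bigD1 p) /=; last by rewrite in_setD in_setD1 eqxx act_p.
rewrite -mulrA mquo_sign mquoX setD1K // coordE => cyc_c.
have sgn2 F p' : sgn F p' * sgn F p' = 1 :> T.
  by rewrite -exprD addnn -mul2n exprM sqrrN !expr1n.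
have {cyc_c} -> : v c = - (sgn (apF c) p * \sum_(p' in active (apm c) :\: apF c)
    mquo (xvar p) (sgn (p' |: (apF c :\ p)) p' * 'X_(xvar p') *
      coord v (p' |: (apF c :\ p)) (apm c))).
  rewrite (eq_bigl (fun p' => (p' \in active (apm c) :\: (apF c :\ p)) && (p' != p)))
    => [|p']; last first.
    by rewrite !in_setD in_set1; case: eqP => [->|]; rewrite ?pc ?andbF //= andbT.
  rewrite -[LHS]mul1r -[X in X * _ = _](sgn2 (apF c) p) -mulrA; move/eqP: cyc_c.
  by rewrite addr_eq0 => /eqP ->; rewrite mulrN.
rewrite mulr_sumr -sumrN; apply: eq_bigr => p' /setDP[act_p' p'c].
have ne : p != p' by apply: contraNneq p'c => <-.
rewrite coord_contraction //; last 2 first.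
- by rewrite subUset sub1set act_p'.
- by rewrite cardsU1 p'c card_c.
rewrite in_setU1 pc orbT.
have HpE : (p' |: apF c) :\ p = p' |: (apF c :\ p).
  by apply/setP => x; rewrite !inE; case: (eqVneq x p') => // ->; rewrite eq_sym ne.
rewrite HpE -[in RHS]mulrA mquo_sign mquo_X ?(inj_eq (@xvar_inj _ _)) //.
have := @sign_position T _ _ (p' |: apF c) p p'.
have ne1 : p.1 != p'.1.
  by apply: contraNneq ne => /(congr1 val) /(active_inj act_p act_p') ->.
rewrite setU11 in_setU1 pc orbT setU1K // HpE => /(_ isT isT ne1).
move: (coord v _ _) => w; move: (sgn2 (p' |: apF c) p) (sgn2 (apF c) p).
move: (sgn (p' |: apF c) p) (sgn (apF c) p) => a e aa ee.
move: (sgn (p' |: apF c) p') (sgn (p' |: apF c :\ p) p') => x y xy.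
have {}xy : x * e = - (a * y) by rewrite xy opprK.
move: (mquo _ _) 'X_(xvar p') => {}w X.
transitivity (x * e * a * e * (X * w)); first by rewrite -[LHS]mul1r -ee; ring.
by rewrite xy -[RHS]mul1r -aa; ring.
Qed.
End Acyclicity.

(** * Clearing the last generator and exactness *)

Section Resolution.
Variables (k : fieldType) (n d : nat) (I : {pred {mpoly k[n]}}).
Hypotheses (I_monomial : monomial_ideal I) (I_borel : borel_fixed I).
Hypothesis I_deg : forall m : 'X_{1..n}, mingen I m -> (mdeg m <= d)%N.
Implicit Types (m : 'X_{1..n}) (p : 'I_n * 'I_d) (F G : {set 'I_n * 'I_d}).
Local Notation T := {mpoly k[n * d]}.
Local Notation angle := (angle I).
Local Notation active := (@active n d).
Local Notation rank := (lexrank d).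
Local Notation P := (Ptilde d I).

Lemma cdiff_cycle (q : nat) (v : cmod P q.+1) (u : cmod P q.+2) :
  cdiff v = 0 -> cdiff (v - cdiff u) = 0.
Proof.
by move=> cyc; rewrite cdiffD cdiffN cyc (Ptilde_is_complex I_monomial) ?subr0.
Qed.

Lemma cdiff0 (q : nat) : cdiff (0 : cmod P q.+1) = 0.
Proof. by rewrite -[0](subrr 0) cdiffD cdiffN subrr. Qed.

(** Clearing [p] kills the coordinates containing [p] and removes from the others the monomials
    divisible by its variable. Earlier variables stay cleared because divisions by different
    variables commute. *)
Lemma koszul_clear (q : nat) (v : cmod P q.+1) m (L : seq ('I_n * 'I_d)) :
  cdiff v = 0 -> rank_below (rank m).+1 v -> {subset L <= active m} ->
  exists2 u : cmod P q.+2, rank_below (rank m).+1 (v - cdiff u) &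
    forall b : adm_pair d I q, apm b = m -> forall p, p \in L ->
      (p \in apF b -> (v - cdiff u) b = 0) /\ mquo (xvar p) ((v - cdiff u) b) = 0.
Proof.
move=> cyc bv; elim: L => [_|p L IH sub_pL].
  by exists 0; rewrite ?cdiff0 ?subr0.
have /IH[u bw clear_w] : {subset L <= active m}.
  by move=> p' L_p'; apply: sub_pL; rewrite inE L_p' orbT.
have act_p : p \in active m by apply: sub_pL; rewrite mem_head.
pose w := v - cdiff u.
have cyc_w : cdiff w = 0 by apply: cdiff_cycle.
exists (u + contraction w m p); rewrite cdiffD opprD addrA -/w.
  apply: rank_belowB => //; apply: rank_below_cdiff => //.
  exact: rank_below_contraction.
move=> b mb p' L_p'; subst m.
have -> : (w - cdiff (contraction w (apm b) p)) b =
    w b - cdiff (contraction w (apm b) p) b.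
  by move: (cdiff _) => x; rewrite !ffunE.
have [pb|pb] := boolP (p \in apF b).
  by rewrite (contraction_in I_monomial) // subrr mquo0.
rewrite (contraction_notin I_monomial) //.
move: L_p'; rewrite inE; case: (eqVneq p' p) => [-> _|ne /= L_p'].
  by split; [rewrite (negPf pb) | rewrite mquoD mquoN mquoX subrr].
have [w0 q0] := clear_w b erefl p' L_p'; split=> [/w0|].
  by rewrite -/(w b) => ->; rewrite mquo0 mulr0 subrr.
rewrite mquoD mquoN mquo_X ?(inj_eq (@xvar_inj _ _)) // mquoC q0.
by rewrite mquo0 mulr0 subrr.
Qed.

(** At the first differing exponent [i], the block of [x_i] in [m'] runs past that in [m] and covers
    position [psum m i.+1]. This position is active, for if [m] ended there it would divide [m']. *)
Lemma lexlt_bpol m m' : mingen I m -> mingen I m' -> lexlt m m' ->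
  exists2 p, p \in active m & (bpol d m (xvar p) < bpol d m' (xvar p))%N.
Proof.
move=> gen_m gen_m' /lexltP[i lt_i eq_i].
have psum_low t : (t <= i)%N -> psum m t = psum m' t.
  move=> ti; apply: eq_bigr => j jt; apply: eq_i; exact: leq_trans ti.
have lt_m : (psum m i.+1 < mdeg m)%N.
  rewrite ltnNge; apply/negP => le_m.
  have mm' : m = m'.
    case/mingenP: gen_m => mI _; case/mingenP: gen_m' => _; apply => //.
    apply/mnm_lepP => j; case: (ltngtP j i) => [/eq_i -> //|ij|/val_inj -> //].
      have := psum_le m ij; have := psumS m j; have := psum_le_mdeg m j.+1; lia.
    exact: ltnW.
  by rewrite mm' ltnn in lt_i.
have lt_d := leq_trans lt_m (I_deg gen_m).
exists (i, Ordinal lt_d); first by apply/activeP.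
rewrite !bpolE /= ltnn andbF; have := psum_low i (leqnn i).
have := psumS m i; have := psumS m' i; lia.
Qed.

(** A monomial [a] of [v b0] must be cancelled by the term of another generator, lexicographically
    larger by the rank bound. Then [lexlt_bpol] yields an active variable dividing [a], against the
    hypothesis on [mquo]. *)
Lemma colon_clear (v : cmod P 1) (b0 : adm_pair d I 0) :
  cdiff v = 0 -> rank_below (rank (apm b0)).+1 v ->
  (forall p, p \in active (apm b0) -> mquo (xvar p) (v b0) = 0) -> v b0 = 0.
Proof.
move=> cyc bv quo0; apply/eqP; rewrite -msupp_eq0 -nilpE.
apply/negPn/negP; case supp_a: (msupp (v b0)) => [//|a s] _.
have {supp_a} nz_a : (v b0)@_a != 0 by rewrite -mcoeff_msupp supp_a mem_head.
have := congr1 (fun w : cmod P 0 => (w tt)@_(bpol d (apm b0) + a)) cyc.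
rewrite /= !ffunE mcoeff0 raddf_sum (bigD1 b0) //= ffunE mcoeffMX.
have [|] := boolP [exists b : adm_pair d I 0,
    (b != b0) && ((v b * 'X_[k, bpol d (apm b)])@_(bpol d (apm b0) + a) != 0)].
  case/existsP=> b /andP[ne nz] _; rewrite mulrC mcoeff_XM in nz.
  case: ifP nz => [le_b nz_b|]; last by rewrite eqxx.
  have F0 (c : adm_pair d I 0) : apF c = set0.
    by case: (adm_pairP c) => _ _ /eqP; rewrite cards_eq0 => /eqP.
  have ne_m : apm b0 != apm b.
    by apply: contraNneq ne => eq_m; apply/eqP/adm_pair_inj; rewrite ?F0.
  have [gen_b0 _ _] := adm_pairP b0; have [gen_b _ _] := adm_pairP b.
  have nz_vb : v b != 0 by apply: contraNneq nz_b => ->; rewrite mcoeff0.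
  have lt_b : lexlt (apm b0) (apm b).
    case/orP: (lexlt_total ne_m) => // /(lexrank_lt (I_deg gen_b0)).
    by rewrite ltnNge -ltnS bv.
  have [p act_p lt_p] := lexlt_bpol gen_b0 gen_b lt_b.
  have le_Ua : (U_(xvar p) <= a)%MM.
    apply/mnm_lepP => x; rewrite mnm1E; case: eqP => // <-.
    by have := mnm_lepP le_b (xvar p); rewrite mnmDE; lia.
  by move: nz_a; rewrite -(submK le_Ua) -mcoeff_mquo quo0 // mcoeff0 eqxx.
rewrite negb_exists => /forallP none; rewrite big1 ?addr0 => [/eqP|b ne].
  by rewrite (negPf nz_a).
by have := none b; rewrite ne ffunE negbK => /eqP.
Qed.

Lemma acyclic_step (q r : nat) (v : cmod P q.+1) :
  cdiff v = 0 -> rank_below r.+1 v ->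
  exists u : cmod P q.+2, rank_below r (v - cdiff u).
Proof.
move=> cyc bv.
have [/existsP[b0 /andP[nz0 /eqP rank0]]|] :=
  boolP [exists b : adm_pair d I q, (v b != 0) && (rank (apm b) == r)]; last first.
  rewrite negb_exists => /forallP none; exists 0; rewrite cdiff0 subr0 => b nz.
  by have := none b; rewrite nz /= => ne; have := bv b nz; rewrite ltnS leq_eqVlt (negPf ne).
rewrite -rank0 in bv *.
have sub_enum : {subset enum (active (apm b0)) <= active (apm b0)}.
  by move=> p; rewrite mem_enum.
have [u bw clear_w] := koszul_clear cyc bv sub_enum; exists u => b nz.
have := bw b nz; rewrite ltnS leq_eqVlt => /orP[/eqP eq_rank|//].
have [gen_b0 _ _] := adm_pairP b0; have [gen_b sub_b card_b] := adm_pairP b.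
have mb : apm b = apm b0 by apply: lexrank_inj eq_rank; apply: I_deg.
(* A nonempty set contains a cleared pair; the empty one occurs only for [q = 0], where the colon
   argument takes over. *)
case/eqP: nz; case: (set_0Vmem (apF b)) => [F0|[p pb]]; last first.
  have L_p : p \in enum (active (apm b0)) by rewrite mem_enum -mb (subsetP sub_b).
  by have [w0 _] := clear_w b mb p L_p; apply: w0.
have q0 : q = 0%N by rewrite -card_b F0 cards0.
subst q; apply: colon_clear; first exact: cdiff_cycle.
  by rewrite mb.
move=> p act_p; have L_p : p \in enum (active (apm b0)) by rewrite mem_enum -mb.
by have [_] := clear_w b mb p L_p.
Qed.

Lemma Ptilde_acyclic : acyclic P.
Proof.
move=> q v cyc.
have [r bv] : exists r, rank_below r v.
  by exists #|{: 'X_{1..n < d.+1}}|.+1 => b _; rewrite ltnS max_card.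
elim: r => [|r IH] in v cyc bv *.
  exists 0; rewrite cdiff0; apply/ffunP => b; rewrite ffunE.
  by apply/esym/eqP/negPn/negP => /bv.
have [u bu] := acyclic_step cyc bv.
have [w dw] := IH _ (cdiff_cycle u cyc) bu.
by exists (w + u); rewrite cdiffD dw subrK.
Qed.

Lemma Ptilde_image (f : T) :
  bpol_ideal d I f <-> exists v : cmod P 1, cdiff v tt = f.
Proof.
split=> [[s sP ->]|[v <-]]; last first.
  rewrite ffunE; apply: ideal_gen_sum => b; apply: ideal_genM; apply: ideal_gen_sub.
  by exists (apm b); [case: (adm_pairP b) | rewrite ffunE].
elim: s sP => [_|x s IH sP].
  by exists 0; rewrite cdiff0 ffunE big_nil.
have [v dv] : exists v : cmod P 1, cdiff v tt = \sum_(y <- s) y.1 * y.2.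
  by apply: IH => y ys; apply: sP; rewrite inE ys orbT.
have [m gen_m x2] := sP x (mem_head _ _).
exists ([ffun b : adm_pair d I 0 => (apm b == m)%:R * x.1] + v).
rewrite cdiffD ffunE dv big_cons; congr (_ + _); rewrite ffunE.
have [b0 [F0 m0]] := adm_pair_exists I_deg gen_m (sub0set _) (cards0 _).
have F0E (c : adm_pair d I 0) : apF c = set0.
  by case: (adm_pairP c) => _ _ /eqP; rewrite cards_eq0 => /eqP.
rewrite (bigD1 b0) //= !ffunE m0 eqxx mul1r -x2 big1 ?addr0 // => b ne.
rewrite ffunE; case: eqP => [mb|]; last by rewrite !mul0r.
by case/eqP: ne; apply: adm_pair_inj; rewrite ?F0E ?mb.
Qed.

Lemma Ptilde_resolves : resolves_quotient P (bpol_ideal d I).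
Proof.
exists tt; first by split=> [[]|].
split; [exact: Ptilde_is_complex | exact: Ptilde_acyclic | exact: Ptilde_image].
Qed.

End Resolution.

Theorem theorem2p6 (k : fieldType) (n d : nat) (I : {pred {mpoly k[n]}})
    (I_monomial : monomial_ideal I) (I_borel : borel_fixed I)
    (I_deg : forall m : 'X_{1..n}, mingen I m -> (mdeg m <= d)%N) :
  [/\ graded (Ptilde d I),
      resolves_quotient (Ptilde d I) (bpol_ideal d I) &
      1 \notin I -> minimal (Ptilde d I)].
Proof.
split; [exact: Ptilde_graded | exact: Ptilde_resolves | exact: Ptilde_minimal].
Qed.
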